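(* Let $\Bbbk$ be a field of characteristic zero. The subspace $P=\{x\in\Lambda:\Delta(x)=1\otimes x+x\otimes 1\}$ of primitive elements of $\Lambda$ is spanned by the elements $m_1$ and $m_{2k}$ for $k\geq1$.
   Context: The algebra of odd symmetric functions: let $\Lambda'$ be the free associative $\mathbb{Z}$-graded $\Bbbk$-algebra on $h_1,h_2,\dots$ with $\deg h_n=n$; set $h_0=1$, $h_n=0$ for $n<0$. Give $\Lambda'\otimes\Lambda'$ the multiplication $(x_1\otimes x_2)(y_1\otimes y_2)=(-1)^{\deg(x_2)\deg(y_1)}x_1y_1\otimes x_2y_2$ on homogeneous elements; the comultiplication $\Delta:\Lambda'\to\Lambda'\otimes\Lambda'$ is the algebra homomorphism with $\Delta(h_n)=\sum_{m=0}^n h_m\otimes h_{n-m}$. For a composition $\alpha=(a_1,\dots,a_k)$ (finite sequence of positive integers) put $h_\alpha=h_{a_1}\cdots h_{a_k}$, $|\alpha|=a_1+\dots+a_k$, $S_\alpha=S_{a_1}\times\dots\times S_{a_k}\subset S_{|\alpha|}$. The symmetric bilinear form on $\Lambda'$ is $(h_\beta,h_\alpha)=\sum_{c\in S_\beta\backslash S_n/S_\alpha}(-1)^{\ell(c)}$ if $|\alpha|=|\beta|=n$, and $0$ if $|\alpha|\ne|\beta|$, where $\ell(c)$ is the Coxeter length of the minimal length element of $c$. Let $\mathcal I$ be the radical of the form and $\Lambda=\Lambda'/\mathcal I$, with the induced grading $\Lambda=\bigoplus_n\Lambda_n$, multiplication, comultiplication and (nondegenerate) form. The elements $h_\lambda$,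 $\lambda\vdash n$, form a basis of $\Lambda_n$. The odd monomial symmetric functions $\{m_\lambda\}_{\lambda\vdash n}$ are the dual basis: $(h_\lambda,m_\mu)=\delta_{\lambda\mu}$. For $n\ge1$, $m_n$ denotes $m_{(n)}$, for the one-part partition $(n)$. *)

(* Defs.v *)
From HB Require Import structures.
From mathcomp Require Import all_boot all_order all_fingroup all_algebra.
From mathcomp Require Import generic_quotient ring_quotient.
From mathcomp Require Import finmap zify monalg boolp.
From mathcomp Require classical_sets.

Set Implicit Arguments.
Unset Strict Implicit.
Unset Printing Implicit Defensive.

Import GRing.Theory.
Local Open Scope ring_scope.
Local Open Scope quotient_scope.

Section Span.
Variables (R : pzRingType) (V : lmodType R).

Definition span_of (S : V -> Prop) : {pred V} := fun x =>
  `[< exists s : seq (R * V),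
      (forall p, p \in s -> S p.2) /\ x = \sum_(p <- s) p.1 *: p.2 >].

Lemma span_of_closed S : submod_closed (span_of S).
Proof.
split; first by apply/asboolP; exists [::]; rewrite big_nil.
move=> a x y /asboolP [s [Ss ->]] /asboolP [t [St ->]]; apply/asboolP.
exists ([seq (a * p.1, p.2) | p <- s] ++ t); split.
  move=> p; rewrite mem_cat => /orP [/mapP [q qs ->]|/St //].
  exact: Ss qs.
rewrite big_cat big_map scaler_sumr /=; congr (_ + _).
by apply: eq_bigr => p _; rewrite scalerA.
Qed.

HB.instance Definition _ S :=
  GRing.isSubmodClosed.Build R V (span_of S) (span_of_closed S).

End Span.

Section QuotientModule.
Variables (R : pzRingType) (V : lmodType R) (I : submodClosed V).

(* The library's submodClosed does not inherit from zmodClosed, which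
   Quotient.quot asks for. *)
Lemma submod_zmod_closed : zmod_closed (I : {pred V}).
Proof.
by split=> [|x y Ix Iy]; rewrite ?rpred0 // -scaleN1r rpredD // rpredZ.
Qed.

Definition submod_zmod : zmodClosed V :=
  HB.pack_for (zmodClosed V) (I : {pred V})
    (GRing.isZmodClosed.Build V (I : {pred V}) submod_zmod_closed).

Definition quotmod : Type := Quotient.quot submod_zmod.
HB.instance Definition _ := GRing.Zmodule.on quotmod.
HB.instance Definition _ := EqQuotient.on quotmod.

Definition projmod : V -> quotmod := \pi_(Quotient.quot submod_zmod).

Lemma projmodP x y : (projmod x == projmod y) = (x - y \in I).
Proof. by rewrite /projmod piE. Qed.

Lemma projmodD x y : projmod (x + y) = projmod x + projmod y.
Proof. by rewrite /projmod piE. Qed.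

Definition reprmod (x : quotmod) : V := repr x.

Lemma reprmodK x : projmod (reprmod x) = x.
Proof. exact: reprK. Qed.

Definition scalemod (a : R) (x : quotmod) : quotmod := projmod (a *: reprmod x).

Lemma projmodZ a x : projmod (a *: x) = scalemod a (projmod x).
Proof.
apply/eqP; rewrite projmodP -scalerBr; apply: rpredZ.
by rewrite -projmodP reprmodK.
Qed.

Lemma scalemodA a b x : scalemod a (scalemod b x) = scalemod (a * b) x.
Proof. by rewrite -[x]reprmodK -!projmodZ scalerA. Qed.

Lemma scalemod1 : left_id 1 scalemod.
Proof. by move=> x; rewrite -[x]reprmodK -projmodZ scale1r. Qed.

Lemma scalemodDr : right_distributive scalemod +%R.
Proof.
move=> a x y.
by rewrite -[x]reprmodK -[y]reprmodK -projmodD -!projmodZ -projmodD scalerDr.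
Qed.

Lemma scalemodDl x : {morph scalemod^~ x : a b / a + b}.
Proof.
by move=> a b /=; rewrite -[x]reprmodK -!projmodZ -projmodD scalerDl.
Qed.

HB.instance Definition _ := GRing.Zmodule_isLmodule.Build R quotmod
  scalemodA scalemod1 scalemodDr scalemodDl.

Lemma projmod_is_linear : linear projmod.
Proof. by move=> a x y; rewrite projmodD projmodZ. Qed.

HB.instance Definition _ :=
  GRing.isLinear.Build R V quotmod _ projmod projmod_is_linear.

End QuotientModule.

Lemma linear_fun0 (R : pzRingType) (U V : lmodType R) (f : U -> V) :
  linear f -> f 0 = 0.
Proof. by move=> lf; have := lf (-1) 0 0; rewrite scaler0 add0r scaleN1r addNr. Qed.

Lemma linear_funZ (R : pzRingType) (U V : lmodType R) (f : U -> V) a x :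
  linear f -> f (a *: x) = a *: f x.
Proof. by move=> lf; rewrite -[a *: x]addr0 lf linear_fun0 // addr0. Qed.

Lemma linear_fun_comp (R : pzRingType) (U V W : lmodType R) (f : V -> W)
  (g : U -> V) : linear f -> linear g -> linear (fun x => f (g x)).
Proof. by move=> lf lg a x y; rewrite lg lf. Qed.

(* The linear map sending the basis element << u >> to b u. *)
HB.lock Definition linext (R : comNzRingType) (K : choiceType) (V : lmodType R)
  (b : K -> V) (x : {malg R[K]}) : V := \sum_(u <- msupp x) x@_u *: b u.
Arguments linext {R K V} b x.

Section LinearExtension.
Variables (R : comNzRingType) (K : choiceType) (V : lmodType R).
Implicit Types (b : K -> V) (x : {malg R[K]}).

Lemma linextEw b x (d : {fset K}) : (msupp x `<=` d)%fset ->
  linext b x = \sum_(u <- d) x@_u *: b u.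
Proof.
move=> le_xd; rewrite linext.unlock (big_fset_incl _ le_xd) //= => u _.
by move/mcoeff_outdom ->; rewrite scale0r.
Qed.

Lemma linext_is_linear b : linear (linext b).
Proof.
move=> a x y; pose d := (msupp x `|` msupp y)%fset.
have le_d : (msupp (a *: x + y) `<=` d)%fset.
  by apply: fsubset_trans (msuppD_le _ _) _; apply/fsetSU/msuppZ_le.
rewrite (linextEw b le_d).
rewrite (linextEw b (fsubsetUl _ _ : msupp x `<=` d)%fset)
  (linextEw b (fsubsetUr _ _ : msupp y `<=` d)%fset).
rewrite scaler_sumr -big_split /=; apply: eq_bigr => u _.
by rewrite mcoeffD mcoeffZ scalerDl scalerA.
Qed.

HB.instance Definition _ b :=
  GRing.isLinear.Build R {malg R[K]} V _ (linext b) (linext_is_linear b).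

Lemma linextU b c u : linext b << c *g u >> = c *: b u.
Proof. by rewrite (linextEw _ msuppU_le) big_seq_fset1 mcoeffUU. Qed.

Lemma linext1 b u : linext b << u >> = b u.
Proof. by rewrite linextU scale1r. Qed.

Lemma linext_linear_family (U : lmodType R) (b : K -> U -> V) x :
  (forall u, linear (b u)) -> linear (fun y => linext (fun u => b u y) x).
Proof.
move=> lb a y z; rewrite linext.unlock scaler_sumr -big_split /=.
by apply: eq_bigr => u _; rewrite lb scalerDr !scalerA [a * _]mulrC.
Qed.

End LinearExtension.

Lemma malgZU (R : comNzRingType) (K : choiceType) (c : R) (u : K) :
  << c *g u >> = c *: << u >> :> {malg R[K]}.
Proof. by apply/malgP => v; rewrite mcoeffZ !mcoeffU mulrnAr mulr1. Qed.

Lemma malg_lin_ext (R : comNzRingType) (K : choiceType) (V : lmodType R)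
    (f g : {malg R[K]} -> V) : linear f -> linear g ->
  (forall u, f << u >> = g << u >>) -> f =1 g.
Proof.
move=> lf lg fg x.
rewrite [x]monalgE; elim: (enum_fset _) => [|u s IHs].
  by rewrite big_nil !linear_fun0.
by rewrite big_cons malgZU lf lg fg IHs.
Qed.

Section CoxeterLength.
Variable n : nat.
Local Open Scope group_scope.

Definition simple_refl : {set 'S_n} :=
  [set s | [exists i : 'I_n, [exists j : 'I_n,
     (j == i.+1 :> nat) && (s == tperm i j)]]].

Lemma simple_reflP (i j : 'I_n) : j = i.+1 :> nat -> tperm i j \in simple_refl.
Proof.
by move=> ij; rewrite inE; apply/existsP; exists i; apply/existsP; exists j;
  rewrite ij !eqxx.
Qed.

Lemma gen_simple_refl : <<simple_refl>> = [set: 'S_n].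
Proof.
have tp m (i j : 'I_n) : j = (i + m).+1 :> nat -> tperm i j \in <<simple_refl>>.
  elim: m j => [|m IHm] j ij; first by rewrite mem_gen ?simple_reflP ?ij ?addn0.
  have lt_n : ((i + m).+1 < n)%N by have := ltn_ord j; lia.
  pose l := Ordinal lt_n.
  have il : tperm i l \in <<simple_refl>> by apply: IHm.
  have lj : tperm l j \in <<simple_refl>>.
    by rewrite mem_gen // simple_reflP //= ij addnS.
  have -> : tperm i j = tperm i l ^ tperm l j.
    rewrite tpermJ tpermL tpermD //; last by rewrite -val_eqE /= ij; lia.
    by rewrite -val_eqE /=; lia.
  by rewrite groupJ.
apply/eqP; rewrite eqEsubset subsetT; apply/subsetP => s _.
have [ts -> _] := prod_tpermP s.
apply: group_prod => t _; case: (ltngtP t.1 t.2) => [lt12|lt21|/val_inj ->].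
- by apply: (tp (t.2 - t.1.+1)%N); lia.
- by rewrite tpermC; apply: (tp (t.1 - t.2.+1)%N); lia.
by rewrite tperm1 group1.
Qed.

Lemma coxeter_length_subproof (s : 'S_n) : exists m, s \in simple_refl ^+ m.
Proof.
have: s \in <<simple_refl>> by rewrite gen_simple_refl inE.
move=> /gen_prodgP [m [c cS ->]]; exists m.
by rewrite -[m in _ ^+ m]card_ord -prodg_const mem_prodg.
Qed.

(* simple_refl ^+ m is the set of products of m simple transpositions. *)
Definition coxeter_length (s : 'S_n) : nat := ex_minn (coxeter_length_subproof s).

(* The permutations preserving each of the consecutive blocks of sizes a_1,
   a_2, ... of {0, ..., n - 1}; reshape_index a i is the block containing i. *)
Definition young (a : seq nat) : {set 'S_n} :=
  [set s : 'S_n | [forall i, reshape_index a (s i) == reshape_index a i]].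

(* Permutations compose left to right here, so s |-> s^-1 identifies these with
   the double cosets for the other convention; it preserves length. *)
Definition double_cosets (b a : seq nat) : {set {set 'S_n}} :=
  [set young b * [set s] * young a | s : 'S_n].

(* fingroup.repr c only provides a starting point in c for the arg min. *)
Definition min_length (c : {set 'S_n}) : nat :=
  coxeter_length [arg min_(s < fingroup.repr c in c) coxeter_length s].

Lemma simple_reflV : simple_refl^-1 = simple_refl.
Proof.
apply/setP => s; rewrite inE; apply/idP/idP => /[1!inE] /existsP [i /existsP [j]].
  by move=> /andP [ij /eqP /(congr1 invg)]; rewrite invgK tpermV => ->;
    apply/simple_reflP/eqP.
by move=> /andP [ij /eqP ->]; rewrite tpermV; apply/simple_reflP/eqP.
Qed.

Lemma coxeter_lengthV s : coxeter_length s^-1 = coxeter_length s.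
Proof.
have V m t : t^-1 \in simple_refl ^+ m -> t \in simple_refl ^+ m.
  rewrite -mem_invg; suff -> : (simple_refl ^+ m)^-1 = simple_refl ^+ m by [].
  elim: m => [|m IHm]; first by rewrite !expg0 invg1.
  by rewrite [in LHS]expgSr invMg simple_reflV IHm -expgS.
have le t : (coxeter_length t^-1 <= coxeter_length t)%N.
  rewrite /coxeter_length; case: ex_minnP => m _; apply.
  by case: ex_minnP => m' t_m' _; apply: V; rewrite invgK.
by apply/eqP; rewrite eqn_leq le -{1}[s]invgK le.
Qed.

Lemma youngV a : (young a)^-1 = young a.
Proof.
have V s : s \in young a -> s^-1 \in young a.
  rewrite !inE => /forallP s_a; apply/forallP => i.
  by have := s_a (s^-1 i); rewrite permKV eq_sym.
by apply/setP => s; rewrite inE; apply/idP/idP => /V; rewrite ?invgK.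
Qed.

Lemma double_cosetV b a c : c \in double_cosets b a -> c^-1 \in double_cosets a b.
Proof.
move=> /imsetP [s _ ->]; apply/imsetP; exists s^-1; first by [].
by rewrite !invMg !youngV invg_set1 mulgA.
Qed.

Lemma min_lengthP (c : {set 'S_n}) s : s \in c ->
  exists2 t, t \in c & coxeter_length t = min_length c /\
    forall u, u \in c -> (coxeter_length t <= coxeter_length u)%N.
Proof.
move=> /mem_repr rc; rewrite /min_length; case: arg_minnP => // t tc t_min.
by exists t.
Qed.

Lemma min_lengthV (c : {set 'S_n}) s : s \in c -> min_length c^-1 = min_length c.
Proof.
move=> sc; have [t tc [<- t_min]] := min_lengthP sc.
have [|t' t'c [<- t'_min]] := @min_lengthP c^-1 s^-1; first by rewrite mem_invg invgK.
apply/eqP; rewrite eqn_leq -{1}(coxeter_lengthV t) t'_min ?mem_invg ?invgK //.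
by rewrite -(coxeter_lengthV t') t_min // -mem_invg.
Qed.

Lemma sum_double_cosetsC (R : pzRingType) b a :
  (\sum_(c in double_cosets b a) (-1) ^+ min_length c =
   \sum_(c in double_cosets a b) (-1) ^+ min_length c :> R)%R.
Proof.
rewrite (reindex_inj invg_inj) /=; apply: eq_big => c.
  by apply/idP/idP => /double_cosetV; rewrite ?invgK.
move=> /double_cosetV; rewrite invgK => /imsetP [s _ c_s].
have sc : s \in c by rewrite c_s; apply/mulsgP; exists s 1%g; rewrite ?mulg1 //;
  [apply/mulsgP; exists 1%g s; rewrite ?mul1g ?set11 // | ];
  by rewrite inE; apply/forallP => i; rewrite perm1.
by rewrite (min_lengthV sc).
Qed.

End CoxeterLength.

(* freeSym k is the free algebra on h_1, h_2, ...; the letter i of a word stands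
   for h_(i+1), so a word is a composition, recovered as parts w. *)

Notation word := {fmonom nat}.
Notation freeSym k := {malg k[word]}.

Local Notation "1" := (@mone _) : monom_scope.
Local Notation "x * y" := (mmul x y) : monom_scope.

Definition parts (w : word) : seq nat := [seq i.+1 | i <- w].
Definition deg (w : word) : nat := sumn (parts w).

Lemma deg1 : deg 1%M = 0%N.
Proof. by rewrite /deg /parts fm1. Qed.

Lemma degM (u v : word) : deg (u * v)%M = (deg u + deg v)%N.
Proof. by rewrite /deg /parts fmM map_cat sumn_cat. Qed.

(* The tensor square of freeSym k, with basis the pairs of words and with the
   sign-twisted multiplication tmul below. *)
Definition freeTens (k : fieldType) : Type := {malg k[(word * word)%type]}.

Section FreeTensor.
Variable k : fieldType.
Local Notation T := (freeTens k).

HB.instance Definition _ := GRing.Lmodule.on T.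

Definition tensf (x y : freeSym k) : T :=
  linext (V := T) (fun u => linext (V := T) (fun v => << (u, v) >>) y) x.

Lemma tensfU u v : tensf << u >> << v >> = << (u, v) >>.
Proof. by rewrite /tensf !linext1. Qed.

Lemma tensf_linearl y : linear (tensf^~ y).
Proof. exact: linext_is_linear. Qed.

Lemma tensf_linearr x : linear (tensf x).
Proof.
by apply: linext_linear_family => u; apply: linext_is_linear.
Qed.

Definition tmul_word (p q : (word * word)%type) : T :=
  (-1) ^+ (deg p.2 * deg q.1) *: << ((p.1 * q.1)%M, (p.2 * q.2)%M) >>.

Definition tmul (x y : T) : T := linext (V := T) (fun p => linext (V := T) (tmul_word p) y) x.

Lemma tmulU p q : tmul << p >> << q >> = tmul_word p q.
Proof. by rewrite /tmul !linext1. Qed.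

Lemma tmul_linearl y : linear (tmul^~ y).
Proof. exact: linext_is_linear. Qed.

Lemma tmul_linearr x : linear (tmul x).
Proof.
by apply: linext_linear_family => u; apply: linext_is_linear.
Qed.

Definition tone : T := << (1%M, 1%M) >>.

Lemma tmulA : associative tmul.
Proof.
have Z x a y : tmul x (a *: y) = a *: tmul x y.
  exact: linear_funZ (tmul_linearr x).
have Zl x a y : tmul (a *: x) y = a *: tmul x y.
  exact: (linear_funZ a x (tmul_linearl y)).
pose C := linear_fun_comp; pose l := tmul_linearl; pose r := tmul_linearr.
move=> x y z; move: x; apply: malg_lin_ext.
- exact: l.
- exact: C (l z) (l y).
move=> p; move: y; apply: malg_lin_ext.
- exact: C (r _) (l z).
- exact: C (l z) (r _).
move=> q; move: z; apply: malg_lin_ext.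
- exact: C (r _) (r _).
- exact: r.
move=> t; rewrite [X in tmul _ X]tmulU [X in _ = tmul X _]tmulU /tmul_word Z Zl.
rewrite [X in _ *: X]tmulU [X in _ = _ *: X]tmulU /tmul_word /= !scalerA.
by rewrite -!exprD !mulmA !degM mulnDr mulnDl [in LHS]addnC -addnA.
Qed.

Lemma tmul1 : left_id tone tmul.
Proof.
apply: malg_lin_ext => [|//|p]; first exact: tmul_linearr.
by rewrite tmulU /tmul_word deg1 expr0 scale1r !mul1m; case: p.
Qed.

Lemma tmulr1 : right_id tone tmul.
Proof.
apply: malg_lin_ext => [|//|p]; first exact: tmul_linearl.
by rewrite tmulU /tmul_word deg1 muln0 expr0 scale1r !mulm1; case: p.
Qed.

Lemma tmulDl : left_distributive tmul +%R.
Proof. by move=> x y z; have := tmul_linearl z 1 x y; rewrite /= !scale1r. Qed.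

Lemma tmulDr : right_distributive tmul +%R.
Proof. by move=> x y z; have := tmul_linearr x 1 y z; rewrite /= !scale1r. Qed.

Lemma tone_neq0 : tone != 0.
Proof. by rewrite monalgU_eq0 oner_neq0. Qed.

HB.instance Definition _ := GRing.Zmodule_isNzRing.Build T
  tmulA tmul1 tmulr1 tmulDl tmulDr tone_neq0.

End FreeTensor.

Section FreeSym.
Variable k : fieldType.
Local Notation L := (freeSym k).

Definition hgen (n : nat) : L := if n is i.+1 then << fmu i >> else 1.
Definition hprod (a : seq nat) : L := \prod_(n <- a) hgen n.

Definition comult_gen (n : nat) : freeTens k :=
  \sum_(m < n.+1) tensf (hgen m) (hgen (n - m)).
Definition comultf (x : L) : freeTens k :=
  linext (fun w : word => \prod_(n <- parts w) comult_gen n) x.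

Lemma comultf_is_linear : linear comultf.
Proof. exact: linext_is_linear. Qed.

Lemma comultf_h n : comultf (hgen n) = comult_gen n.
Proof.
case: n => [|n]; rewrite /comultf linext1; last by rewrite /parts fmU big_seq1.
by rewrite /parts fm1 big_nil /comult_gen big_ord_recl big_ord0 addr0 tensfU.
Qed.

Lemma comultfM x y : comultf (x * y) = comultf x * comultf y.
Proof.
pose C := linear_fun_comp; pose D := comultf_is_linear.
have Ml z : linear (fun t : L => t * z).
  by move=> a u v; rewrite mulrDl -scalerAl.
have Mr z : linear (fun t : L => z * t).
  have comm a : z * a%:MP = a%:MP * z.
    rewrite !malgM_def fgmulgU fgmulUg; apply: eq_bigr => u _.
    by rewrite mulm1 mul1m mulrC.
  by move=> a u v; rewrite mulrDr -mul_malgC mulrA comm -mulrA mul_malgC.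
move: x; apply: malg_lin_ext.
- exact: C D (Ml y).
- exact: C (tmul_linearl _) D.
move=> u; move: y; apply: malg_lin_ext.
- exact: C D (Mr _).
- exact: C (tmul_linearr _) D.
move=> v; rewrite -[X in comultf X]/(fgmul << u >> << v >>) fgmulUU mulr1.
by rewrite /comultf !linext1 /parts fmM map_cat big_cat.
Qed.

(* homogf n 0 holds for every n. *)
Definition homogf (n : nat) (x : L) : Prop := forall w, w \in msupp x -> deg w = n.

Definition form_word (b a : seq nat) : k :=
  if sumn b == sumn a then
    \sum_(c in double_cosets (sumn a) b a) (-1) ^+ min_length c
  else 0.

Definition formf (x y : L) : k :=
  linext (V := k^o)
    (fun u => linext (V := k^o) (fun v => form_word (parts u) (parts v)) y) x.

Lemma formf_linearl y : linear (formf^~ y : L -> k^o).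
Proof. exact: linext_is_linear. Qed.

Lemma formf_linearr x : linear (formf x : L -> k^o).
Proof.
by apply: linext_linear_family => u; apply: linext_is_linear.
Qed.

Lemma form_wordC b a : form_word b a = form_word a b.
Proof.
rewrite /form_word [sumn a == _]eq_sym; case: eqP => // ->.
exact: sum_double_cosetsC.
Qed.

Lemma formfC x y : formf x y = formf y x.
Proof.
move: x; apply: (@malg_lin_ext _ _ k^o).
- exact: formf_linearl.
- exact: formf_linearr.
move=> u; move: y; apply: (@malg_lin_ext _ _ k^o).
- exact: formf_linearr.
- exact: formf_linearl.
by move=> v; rewrite /formf !linext1 form_wordC.
Qed.

Definition radical : {pred L} := fun x => `[< forall y, formf x y = 0 >].

Lemma radical_closed : submod_closed radical.
Proof.
split; first by apply/asboolP => y; exact: linear_fun0 (formf_linearl y).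
move=> a x y /asboolP x0 /asboolP y0; apply/asboolP => z.
by rewrite formf_linearl x0 y0 scaler0 addr0.
Qed.

HB.instance Definition _ :=
  GRing.isSubmodClosed.Build k L radical radical_closed.

(* radical (x) L + L (x) radical, the kernel of the projection from L (x) L
   onto (L / radical) (x) (L / radical). *)
Definition tens_radical : {pred freeTens k} :=
  span_of (fun t => exists x y : L,
    (x \in radical \/ y \in radical) /\ t = tensf x y).

HB.instance Definition _ := GRing.SubmodClosed.on tens_radical.

End FreeSym.

Arguments hgen k n : clear implicits.
Arguments hprod k a : clear implicits.
Arguments form_word k b a : clear implicits.
Arguments radical k x : clear implicits.
Arguments tens_radical k x : clear implicits.

Section OddSym.
Variable k : fieldType.

Definition oddSym : Type := quotmod (radical k).
HB.instance Definition _ := GRing.Lmodule.on oddSym.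

Definition oddTens : Type := quotmod (tens_radical k).
HB.instance Definition _ := GRing.Lmodule.on oddTens.

Definition osym : freeSym k -> oddSym := @projmod _ _ (radical k).
Definition otens : freeTens k -> oddTens := @projmod _ _ (tens_radical k).
Definition olift : oddSym -> freeSym k := @reprmod _ _ (radical k).

Definition h_ (a : seq nat) : oddSym := osym (hprod k a).

Definition tens (x y : oddSym) : oddTens := otens (tensf (olift x) (olift y)).
Definition form (x y : oddSym) : k := formf (olift x) (olift y).
(* The radical of the form is a coideal, so comult (osym y) does not depend on
   the representative chosen by olift. *)
Definition comult (x : oddSym) : oddTens := otens (comultf (olift x)).

Definition homog (n : nat) (x : oddSym) : Prop :=
  exists2 y, homogf n y & x = osym y.

Lemma oliftP x : olift (osym x) - x \in radical k.
Proof. by rewrite -(projmodP (radical k)); apply/eqP/reprmodK. Qed.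

Lemma form_osym x y : form (osym x) (osym y) = formf x y.
Proof.
have E u v : formf (olift (osym u)) v = formf u v.
  have /asboolP /(_ v) u0 := oliftP u.
  have := formf_linearl v 1 (olift (osym u) - u) u.
  by rewrite scale1r subrK => ->; rewrite u0 scaler0 add0r.
by rewrite /form E formfC E formfC.
Qed.

Lemma tens_osym x y : tens (osym x) (osym y) = otens (tensf x y).
Proof.
have tens_rad u v : u \in radical k \/ v \in radical k ->
    otens (tensf u v) = 0.
  move=> uv; apply/eqP; rewrite -(linear_fun0 (projmod_is_linear _)).
  rewrite (projmodP (tens_radical k)) subr0; apply/asboolP.
  exists [:: (1, tensf u v)]; rewrite big_seq1 scale1r; split=> // p.
  by rewrite inE => /eqP ->; exists u, v.
have otensD u v : otens (u + v) = otens u + otens v by exact: projmodD.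
have := tensf_linearl (olift (osym y)) 1 (olift (osym x) - x) x.
rewrite /= scale1r subrK scale1r /tens => ->; rewrite otensD tens_rad ?add0r.
  have := tensf_linearr x 1 (olift (osym y) - y) y.
  rewrite scale1r subrK scale1r => ->; rewrite otensD tens_rad ?add0r //.
  by right; apply: oliftP.
by left; apply: oliftP.
Qed.

Definition is_part (l : seq nat) : bool := sorted geq l && (0%N \notin l).

Definition is_monomial (l : seq nat) (x : oddSym) : Prop :=
  homog (sumn l) x /\
  forall mu, is_part mu -> sumn mu = sumn l -> form (h_ mu) x = (mu == l)%:R.

(* The element of the basis dual to the h_mu, mu a partition of sumn l, that
   corresponds to l: it exists and is unique because the h_mu form a basis of
   the homogeneous component and the form is nondegenerate there. *)
Definition m_ (l : seq nat) : oddSym := classical_sets.xget 0 (is_monomial l).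

Definition primitive : {pred oddSym} :=
  fun x => comult x == tens (osym 1) x + tens x (osym 1).

End OddSym.

Arguments primitive k x : clear implicits.

(* Main.v *)
(* Skewing by h_p gives operators S_p adjoint to left multiplication by h_p; they
   satisfy a signed Leibniz rule read off from the coproduct. Consequently
   (x y, z) = (x (x) y, Delta z), so the radical is an ideal, and x is primitive
   if and only if it is orthogonal to 1 and to every product of at least two
   generators; x is then determined by the numbers (x, h_n).
   The numbers (h_w, h_i h_j) have a generating function with a symmetry that
   yields quadratic relations between the h_n modulo the radical. For odd
   n >= 3 they contain 2 h_n = h_1 h_(n-1) + h_(n-1) h_1, so (x, h_n) = 0; they
   also straighten every product of generators into the h_mu, mu a partition,
   whence m_n is unique. For n = 2k an element dual to h_n and orthogonal to all
   other products comes from Newton's identities, applied to elements of even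
   degree that behave modulo the radical like elementary symmetric functions. *)

(* The form is given by minimal lengths of double cosets, which say nothing directly about products.
   The bridge is combinatorial: a double coset is determined by the word of blocks that its minimal
   element visits, its minimal length is the number of inversions of that word, and cutting off the
   first block of the word gives a recursion. Skewing a product of generators by h_p obeys the same
   recursion, which is why skewing is adjoint to multiplication. The even power sums imitate
   ordinary symmetric functions, where E(t)E(-t) is the product of the factors 1 - x^2 t^2: [zval]
   plays the part of its coefficients, so Newton's identities for the squares of the variables
   produce p_2k. They are available only modulo the radical, hence the projection [pr] in that
   argument. Coproducts live in a quotient of the tensor square; pairing with pure tensors detects
   the kernel, so primitivity becomes a statement about the form alone. Since [m_] is a choice with
   default 0, m_1 and m_2k are identified by exhibiting elements with the required pairings and
   proving uniqueness. *)
From HB Require Import structures.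
From mathcomp Require Import all_boot all_order all_fingroup all_algebra.
From mathcomp Require Import finmap zify ring monalg boolp.
From mathcomp Require classical_sets.
Require Import Defs.

Set Implicit Arguments.
Unset Strict Implicit.
Unset Printing Implicit Defensive.

Import GRing.Theory.

Local Open Scope ring_scope.

Local Notation "1" := (@mone _) : monom_scope.
Local Notation "x * y" := (mmul x y) : monom_scope.

(** * Coxeter length as the number of inversions *)

Section Inversions.
Variable n : nat.
Local Open Scope nat_scope.
Local Open Scope group_scope.
Implicit Types s t : 'S_n.

Definition inversions s : {set 'I_n * 'I_n} :=
  [set p : 'I_n * 'I_n | (p.1 < p.2)%N && (s p.2 < s p.1)%N].

(** As i and j are adjacent, swapping them preserves the order of every pair of positions except (i,
    j). The swap therefore carries the inversions of [s] to inversions of the product, and (i, j) is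
    the only new one. *)
Lemma inversions_ascent (i j : 'I_n) s : j = i.+1 :> nat -> (s i < s j)%N ->
  #|inversions (tperm i j * s)| = #|inversions s|.+1.
Proof.
move=> ij lt_s; set r := tperm i j; pose f (p : 'I_n * 'I_n) := (r p.1, r p.2).
have rr x : r (r x) = x by rewrite tpermK.
have f_inj : injective f.
  by apply: (can_inj (g := f)) => -[x y]; rewrite /f /= !rr.
have r_mono (x y : 'I_n) : (x < y)%N -> ~~ ((x == i) && (y == j)) -> (r x < r y)%N.
  have rE (z : 'I_n) : r z = (if z == i :> nat then j else if z == j :> nat then i else z) :> nat.
    rewrite /r permE /=; by do 2?[case: ifP => _].
  by rewrite !rE -!val_eqE /= ij; do ?[case: ifP => ?]; lia.
have -> : inversions (r * s) = (i, j) |: f @: inversions s.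
  apply/setP => -[x y]; rewrite !inE /= !permM.
  have -> : ((x, y) \in f @: inversions s) = (f (x, y) \in inversions s).
    have {1}-> : (x, y) = f (f (x, y)) by rewrite /f /= !rr.
    exact: mem_imset.
  rewrite inE /= xpair_eqE.
  have [/andP[/eqP -> /eqP ->]|nxy] /= := boolP ((x == i) && (y == j)).
    by rewrite /r tpermL tpermR ij leqnn lt_s.
  have [lt_xy|le_yx] := ltnP x y; first by rewrite r_mono.
  apply/esym/negbTE; apply/andP => -[lt_r lt_sr].
  have : ~~ ((r x == i) && (r y == j)).
    by apply/andP => -[/eqP e1 /eqP e2]; move: lt_sr; rewrite e1 e2; lia.
  by move=> /(r_mono _ _ lt_r); rewrite !rr; lia.
rewrite cardsU1 card_imset //; case: imsetP => // -[[x y]].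
rewrite inE /= => /andP[lt_xy lt_s'] [ei ej].
have ex : x = j by rewrite -[x]rr -ei /r tpermL.
have ey : y = i by rewrite -[y]rr -ej /r tpermR.
by move: lt_xy; rewrite ex ey ij; lia.
Qed.

Lemma no_descent_increasing s :
  (forall i j : 'I_n, j = i.+1 :> nat -> (s i < s j)%N) ->
  forall i j : 'I_n, (i < j)%N -> (s i < s j)%N.
Proof.
move=> s_asc; have inc m (i j : 'I_n) : j = (i + m).+1 :> nat -> (s i < s j)%N.
  elim: m j => [|m IHm] j ij; first by apply: s_asc; rewrite ij addn0.
  have lt_n : ((i + m).+1 < n)%N by have := ltn_ord j; lia.
  apply: ltn_trans (IHm (Ordinal lt_n) _) (s_asc _ _ _) => //=.
  by rewrite ij addnS.
by move=> i j lt_ij; apply: (inc (j - i.+1)%N); lia.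
Qed.

Lemma increasing_perm_ge s : (forall i j : 'I_n, (i < j)%N -> (s i < s j)%N) ->
  forall i : 'I_n, (i <= s i)%N.
Proof.
move=> s_inc [i lt_i]; elim: i lt_i => // i IHi lt_i.
by apply: leq_ltn_trans (IHi (ltnW lt_i)) (s_inc _ _ _) => /=.
Qed.

(** Both [s] and its inverse are increasing, hence both lie pointwise above the identity. *)
Lemma increasing_perm1 s : (forall i j : 'I_n, (i < j)%N -> (s i < s j)%N) -> s = 1.
Proof.
move=> s_inc; have sV_inc (i j : 'I_n) : (i < j)%N -> (s^-1 i < s^-1 j)%N.
  move=> lt_ij; case: (ltngtP (s^-1 i) (s^-1 j)) => [//|/s_inc|/val_inj/perm_inj eq_ij].
    by rewrite !permKV; lia.
  by move: lt_ij; rewrite eq_ij ltnn.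
apply/permP => i; apply/val_inj/eqP; rewrite perm1 eqn_leq increasing_perm_ge //.
by rewrite andbT; have := increasing_perm_ge sV_inc (s i); rewrite permK.
Qed.

(** Removing an adjacent descent lowers the number of inversions by one, so that many generators
    suffice; conversely a generator changes this number by one, so no shorter product exists. *)
Lemma coxeter_lengthE s : coxeter_length s = #|inversions s|.
Proof.
rewrite /coxeter_length; case: ex_minnP => m s_m m_min.
apply/eqP; rewrite eqn_leq; apply/andP; split.
  apply: m_min; have [l s_l] : exists l, #|inversions s| = l by exists #|inversions s|.
  rewrite s_l; elim: l s s_l {s_m} => [|l IHl] s s_l.
    suff -> : s = 1 by rewrite expg0 inE.
    apply: increasing_perm1 => i j lt_ij; rewrite ltnNge leq_eqVlt.
    apply/negP => /orP[/eqP/val_inj/perm_inj eq_ij|lt_s].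
      by move: lt_ij; rewrite eq_ij ltnn.
    by have /setP/(_ (i, j)) := cards0_eq s_l; rewrite !inE /= lt_ij lt_s.
  have [/existsP[i /existsP[j /andP[/eqP ij lt_s]]]|] :=
      boolP [exists i : 'I_n, exists j : 'I_n, (j == i.+1 :> nat) && (s j < s i)%N].
    have -> : s = tperm i j * (tperm i j * s) by rewrite mulgA tperm2 mul1g.
    rewrite expgS mem_mulg ?simple_reflP //; apply: IHl; apply: succn_inj.
    by rewrite -s_l -(inversions_ascent ij) ?permM ?tpermL ?tpermR // mulgA tperm2 mul1g.
  move=> /existsP no_desc; have s1 : s = 1.
    apply: increasing_perm1; apply: no_descent_increasing => i j ij.
    rewrite ltnNge leq_eqVlt; apply/negP => /orP[/eqP/val_inj/perm_inj eq_ij|lt_s].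
      by move: ij; rewrite eq_ij; lia.
    by apply: no_desc; exists i; apply/existsP; exists j; rewrite ij eqxx.
  have := s_l; suff -> : inversions s = set0 by rewrite cards0.
  by apply/setP => -[i j]; rewrite !inE s1 !perm1 /=; lia.
elim: m s s_m {m_min} => [|m IHm] s.
  rewrite expg0 => /set1P ->; rewrite leqn0 cards_eq0; apply/eqP/setP => -[i j].
  by rewrite !inE !perm1 /=; lia.
rewrite expgS => /mulsgP[r t r_refl t_m ->]; move: r_refl; rewrite inE.
move=> /existsP[i /existsP[j /andP[/eqP ij /eqP ->]]].
have := IHm t t_m; have [lt_t|] := ltnP (t i) (t j); first by rewrite inversions_ascent.
rewrite leq_eqVlt => /orP[/eqP/val_inj/perm_inj eq_ij|lt_t].
  by move: ij; rewrite eq_ij; lia.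
have := @inversions_ascent i j (tperm i j * t) ij.
rewrite !permM tpermL tpermR mulgA tperm2 mul1g => /(_ lt_t) ->.
by move=> inv_lt; apply: ltnW (ltnW _).
Qed.

End Inversions.

(** * Words of blocks and their inversions *)

Section AllPairs.
Variables (A B C : eqType) (f : A -> B -> C) (s : seq A) (t : A -> seq B).

Lemma mem_allpairsP z :
  reflect (exists x y, [/\ x \in s, y \in t x & z = f x y])
    (z \in [seq f x y | x <- s, y <- t x]).
Proof. exact: (@allpairsPdep A (fun=> B)). Qed.


Lemma uniq_allpairs : uniq s -> {in s, forall x, uniq (t x)} ->
  (forall x y x' y', x \in s -> y \in t x -> x' \in s -> y' \in t x' ->
    f x y = f x' y' -> x = x' /\ y = y') ->
  uniq [seq f x y | x <- s, y <- t x].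
Proof.
move=> s_uniq t_uniq f_inj; apply: (@allpairs_uniq_dep A (fun=> B)) => //.
move=> _ _ /allpairsPdep[x [y [xs yt ->]]] /allpairsPdep[x' [y' [xs' yt' ->]]].
by move=> /= /(f_inj _ _ _ _ xs yt xs' yt')[-> ->].
Qed.

End AllPairs.
Arguments mem_allpairsP {A B C f s t z}.

Section WordInversions.
Local Open Scope nat_scope.
Implicit Types (a b c d u v w : seq nat).

Fixpoint winv w := if w is x :: w' then count (fun y => y < x) w' + winv w' else 0.

Definition winv_cross u v := \sum_(x <- u) count (fun y => y < x) v.

Lemma winv_cat u v : winv (u ++ v) = winv u + winv v + winv_cross u v.
Proof.
rewrite /winv_cross; elim: u => [|x u IHu] /=; first by rewrite big_nil addn0.
by rewrite big_cons IHu count_cat; lia.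
Qed.

Lemma winv_sorted w : sorted leq w -> winv w = 0.
Proof.
elim: w => //= x w IHw; rewrite (path_sortedE leq_trans) => /andP[x_min /IHw ->].
by rewrite addn0; elim: w x_min {IHw} => //= y w IHw /andP[le_xy /IHw ->]; lia.
Qed.

Fixpoint sorted_word m c :=
  if c is x :: c' then nseq x m ++ sorted_word m.+1 c' else [::].

Lemma sorted_word_ge m c : all (leq m) (sorted_word m c).
Proof.
elim: c m => //= x c IHc m; rewrite all_cat all_nseq leqnn orbT /=.
by apply: sub_all (IHc m.+1) => y /ltnW.
Qed.

Lemma sorted_wordP m c : sorted leq (sorted_word m c).
Proof.
elim: c m => //= x c IHc m; elim: x => [|x IHx] //=.
rewrite (path_sortedE leq_trans) IHx andbT all_cat all_nseq leqnn orbT /=.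
by apply: sub_all (sorted_word_ge m.+1 c) => y /ltnW.
Qed.

Lemma size_sorted_word m c : size (sorted_word m c) = sumn c.
Proof. by elim: c m => //= x c IHc m; rewrite size_cat size_nseq IHc. Qed.

Lemma count_sorted_word m c j :
  count_mem j (sorted_word m c) = if m <= j then nth 0 c (j - m) else 0.
Proof.
elim: c m => [|x c IHc] m /=; first by rewrite nth_nil if_same.
rewrite count_cat count_nseq IHc /=; case: (ltngtP m j) => [lt_mj|lt_jm|->].
- by rewrite mul0n subnS; case: (j - m) (subn_gt0 m j) => [|l] //=; rewrite lt_mj.
- by rewrite mul0n.
by rewrite subnn /= mul1n addn0.
Qed.

Lemma big_sorted_word (F : nat -> nat) m c :
  \sum_(x <- sorted_word m c) F x = \sum_(j < size c) nth 0 c j * F (m + j).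
Proof.
elim: c m => [|x c IHc] m /=; first by rewrite big_nil big_ord0.
rewrite big_cat IHc big_ord_recl /= addn0; congr (_ + _).
  by elim: x => [|x IHx] /=; rewrite ?big_nil // big_cons IHx mulSn.
by apply: eq_bigr => j _; rewrite addSnnS.
Qed.

(** Filtering the range 0, ..., p keeps the summation index of the Leibniz rule [perpM], so that
    [perp_hprod] can compare sums term by term. *)
Definition split_heads p x := [seq y <- iota 0 p.+1 | y <= x].

Fixpoint splits p a : seq (seq nat) :=
  if a is x :: a' then
    [seq y :: c | y <- split_heads p x, c <- splits (p - y) a']
  else if p == 0 then [:: [::]] else [::].

Lemma splits_cons p x a :
  splits p (x :: a) = [seq y :: c | y <- split_heads p x, c <- splits (p - y) a].
Proof. by []. Qed.

Definition seq_sub a c := [seq x.1 - x.2 | x <- zip a c].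

(** The number of inversions between a word of content [c] and a later word of content [d]. *)
Fixpoint cross c d :=
  if c is _ :: c' then
    if d is y :: d' then y * sumn c' + cross c' d' else 0
  else 0.

Lemma mem_splits p a c : (c \in splits p a) =
  [&& size c == size a, all2 leq c a & sumn c == p].
Proof.
elim: a p c => [|x a IHa] p c; first rewrite /=.
  by case: eqVneq => [->|p0]; case: c => [|y c] //=; rewrite eq_sym (negbTE p0).
rewrite splits_cons; apply/idP/idP => [/mem_allpairsP[y [s [+ + ->]]]|].
  rewrite mem_filter mem_iota IHa => /andP[le_yx le_yp] /and3P[/eqP sz le_ca /eqP sp].
  by rewrite /= sz eqxx le_yx le_ca sp; apply/eqP; lia.
case: c => [//|y c] /and3P[/eqP[sz] /andP[le_yx]].
rewrite -/(all2 leq c a) => le_ca /eqP <-.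
apply/mem_allpairsP; exists y, c.
by rewrite mem_filter mem_iota le_yx IHa sz le_ca addKn !eqxx; split=> //=; lia.
Qed.

Lemma splits_uniq p a : uniq (splits p a).
Proof.
elim: a p => [|x a IHa] p; first by rewrite /=; case: eqP.
rewrite splits_cons; apply: uniq_allpairs => [|y _|]; rewrite ?filter_uniq ?iota_uniq //.
by move=> y s y' s' _ _ _ _ [-> ->].
Qed.

Lemma size_seq_sub a c : size c = size a -> size (seq_sub a c) = size a.
Proof. by move=> sz; rewrite size_map size_zip sz minnn. Qed.

Lemma nth_seq_sub a c j : size c = size a ->
  nth 0 (seq_sub a c) j = nth 0 a j - nth 0 c j.
Proof.
move=> sz; have [lt_j|le_j] := ltnP j (size a).
  by rewrite (nth_map (0, 0)) ?nth_zip // size_zip sz minnn.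
by rewrite !nth_default // ?sz // size_seq_sub.
Qed.

Lemma all2_leqP c a : size c = size a ->
  reflect (forall j, nth 0 c j <= nth 0 a j) (all2 leq c a).
Proof.
elim: c a => [|x c IHc] [|y a] //=; first by move=> _; left=> j.
move=> [sz]; apply: (iffP andP) => [[le_xy /(IHc _ sz) le_ca] [|j] //=|le_ca].
by split; [exact: (le_ca 0) | apply/(IHc _ sz) => j; exact: (le_ca j.+1)].
Qed.

Lemma sumn_leq_all2 a c : size c = size a -> all2 leq c a -> sumn c <= sumn a.
Proof.
elim: c a => [|x c IHc] [|y a] // [/IHc le_sum] /andP[le_xy /le_sum]; exact: leq_add.
Qed.

Lemma sumn_seq_sub a c : size c = size a -> all2 leq c a ->
  sumn (seq_sub a c) = sumn a - sumn c.
Proof.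
elim: c a => [|x c IHc] [|y a] //= [sz] /andP[le_xy le_ca].
by rewrite -[map _ _]/(seq_sub a c) IHc //; have := sumn_leq_all2 sz le_ca; lia.
Qed.

Lemma crossE c d : size c = size d ->
  cross c d = \sum_(j < size c) nth 0 c j * \sum_(i < j) nth 0 d i.
Proof.
elim: c d => [|x c IHc] [|y d] //; first by rewrite big_ord0.
move=> [sz] /=.
rewrite big_ord_recl big_ord0 muln0 add0n IHc // sumnE (big_nth 0) big_mkord.
rewrite big_distrr -big_split /=; apply: eq_bigr => j _.
by rewrite /bump /= big_ord_recl /= mulnDr mulnC.
Qed.

Lemma sumn0_nth a : sumn a = 0 <-> forall j, nth 0 a j = 0.
Proof.
elim: a => [|x a IHa] /=; first by split=> // _ j; rewrite nth_nil.
split=> [|a0]; last first.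
  by have /= -> := a0 0; apply/IHa => j; apply: (a0 j.+1).
by move/eqP; rewrite addn_eq0 => /andP[/eqP -> /eqP/IHa a0] [|j] //=.
Qed.

(* A double coset of S_b and S_a in S_n is encoded by the word listing the a-block
   of t 0, t 1, ..., where t is its minimal element: words b a lists the words
   with nth 0 a j letters j that increase on each b-block. *)
Fixpoint words b a : seq (seq nat) :=
  if b is p :: b' then
    [seq sorted_word 0 c ++ w | c <- splits p a, w <- words b' (seq_sub a c)]
  else if sumn a == 0 then [:: [::]] else [::].

Lemma wordsP b a w : reflect
  [/\ size w = sumn b, forall j, count_mem j w = nth 0 a j &
      all (sorted leq) (reshape b w)]
  (w \in words b a).
Proof.
elim: b a w => [|p b IHb] a w /=.
  case: eqP => [/sumn0_nth a0|na0].
    by rewrite inE; apply: (iffP eqP) => [->|[/size0nil]] //; split=> // j; rewrite a0.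
  rewrite in_nil; right=> -[/size0nil -> w_a _]; apply: na0.
  by apply/sumn0_nth => j; rewrite -w_a.
apply: (iffP mem_allpairsP) => [[c [v [+ + ->]]]|[sz w_a /andP[srt srts]]].
  rewrite mem_splits => /and3P[/eqP sz le_ca /eqP <-] /IHb[sz_v v_a v_srt].
  have szc := size_sorted_word 0 c.
  rewrite size_cat szc sz_v -szc take_size_cat // drop_size_cat // v_srt sorted_wordP.
  split=> // j; rewrite count_cat count_sorted_word subn0 /= v_a nth_seq_sub //.
  by rewrite subnKC //; apply/all2_leqP.
(* The choice is forced: a sorted block is determined by its letter counts. *)
set u := take p w in srt; pose c := mkseq (fun j => count_mem j u) (size a).
have szu : size u = p by rewrite size_takel // sz leq_addr.
have u_c j : count_mem j u = nth 0 c j.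
  have [lt_j|le_j] := ltnP j (size a); first by rewrite nth_mkseq.
  rewrite [RHS]nth_default ?size_mkseq //; apply/eqP; rewrite -leqn0.
  by rewrite -[X in _ <= X](nth_default 0 le_j) -w_a -[w](cat_take_drop p) count_cat leq_addr.
have u_w : u = sorted_word 0 c.
  apply: (sorted_eq leq_trans anti_leq) => //; first exact: sorted_wordP.
  by apply/allP => j _ /=; rewrite u_c count_sorted_word subn0.
have szc : size c = size a by rewrite size_mkseq.
exists c, (drop p w); split; last by rewrite -u_w cat_take_drop.
  rewrite mem_splits szc eqxx -(size_sorted_word 0) -u_w szu eqxx andbT /=.
  apply/all2_leqP => // j.
  by rewrite -u_c -w_a -[w](cat_take_drop p) count_cat leq_addr.
apply/IHb; split=> // [|j]; first by rewrite size_drop sz addKn.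
by rewrite nth_seq_sub // -w_a -u_c -{2}[w](cat_take_drop p) count_cat addKn.
Qed.

Lemma words_uniq b a : uniq (words b a).
Proof.
elim: b a => [|p b IHb] a /=; first by case: eqP.
apply: uniq_allpairs => [|c _|]; rewrite ?splits_uniq //.
move=> c w c' w' + _ + _; rewrite !mem_splits.
move=> /and3P[/eqP sz _ /eqP szc] /and3P[/eqP sz' _ /eqP szc'] /eqP.
rewrite eqseq_cat ?size_sorted_word ?szc ?szc' // => /andP[/eqP eq_c /eqP ->].
suff -> : c = c' by [].
apply: (@eq_from_nth _ 0) => [|j _]; first by rewrite sz sz'.
by have := count_sorted_word 0 c j; rewrite eq_c count_sorted_word subn0.
Qed.

(** The first block is sorted, so it has no inversions of its own, and its inversions with the rest
    depend only on the two contents. *)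
Lemma winv_words c a w : size c = size a ->
  (forall j, count_mem j w = nth 0 (seq_sub a c) j) ->
  winv (sorted_word 0 c ++ w) = cross c (seq_sub a c) + winv w.
Proof.
move=> sz w_a; rewrite winv_cat winv_sorted ?sorted_wordP // add0n addnC.
congr (_ + _); rewrite /winv_cross big_sorted_word crossE ?size_seq_sub //.
apply: eq_bigr => j _; congr (_ * _).
under [RHS]eq_bigr => i _ do rewrite -w_a.
rewrite add0n; elim: {w_a}w => [|x w IHw] /=; first by rewrite big1.
rewrite big_split /= -IHw; congr (_ + _); have [lt_xj|le_jx] := ltnP x j.
  rewrite (bigD1 (Ordinal lt_xj)) //= eqxx big1 // => i.
  by rewrite -val_eqE /= eq_sym => /negbTE ->.
by rewrite big1 // => i _; case: eqP => // xi; have := ltn_ord i; lia.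
Qed.

End WordInversions.

(** * The form as a recursion on blocks *)

Section FormRecursion.
Variable R : pzRingType.

(** A signed count of the nonnegative integer matrices with row sums [b] and column sums [a],
    expanded along the first row [c]. *)
Fixpoint form_rec (b a : seq nat) : R :=
  if b is p :: b' then
    \sum_(c <- splits p a) (-1) ^+ cross c (seq_sub a c) * form_rec b' (seq_sub a c)
  else (sumn a == 0%N)%:R.

Lemma form_rec_words b a : form_rec b a = \sum_(w <- words b a) (-1) ^+ winv w.
Proof.
elim: b a => [|p b IHb] a /=.
  by case: eqP; rewrite ?big_seq1 ?big_nil ?expr0.
rewrite big_allpairs_dep; apply: eq_big_seq => c.
rewrite mem_splits => /and3P[/eqP sz _ _]; rewrite IHb big_distrr /=.
apply: eq_big_seq => w /wordsP[_ w_a _].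
by rewrite (winv_words sz w_a) exprD.
Qed.

Lemma form_rec_neq b a : sumn b != sumn a -> form_rec b a = 0.
Proof.
elim: b a => [|p b IHb] a /=; first by rewrite eq_sym => /negbTE ->.
move=> neq; rewrite big_seq big1 // => c; rewrite mem_splits.
move=> /and3P[/eqP sz le_ca /eqP cp]; rewrite IHb ?mulr0 // sumn_seq_sub // cp.
by apply: contra neq => /eqP ->; rewrite subnKC // -cp sumn_leq_all2.
Qed.

End FormRecursion.

(** * Double cosets of Young subgroups and their minimal elements *)

Section ReshapeIndex.
Local Open Scope nat_scope.
Implicit Types a b w : seq nat.

Lemma reshape_index_cons x a i :
  reshape_index (x :: a) i = if i < x then 0 else (reshape_index a (i - x)).+1.
Proof.
rewrite /reshape_index /=; have [lt_ix|le_xi] := ltnP i x.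
  by have /eqP -> : i.+1 - x == 0 by rewrite subn_eq0.
by rewrite subSn.
Qed.

Lemma leq_reshape_index a i j : i <= j -> reshape_index a i <= reshape_index a j.
Proof. by rewrite (reshape_leq a) => /orP[/ltnW|/andP[/eqP ->]]. Qed.

Lemma count_reshape_index a j :
  count_mem j [seq reshape_index a i | i <- iota 0 (sumn a)] = nth 0 a j.
Proof.
elim: a j => [|x a IHa] j /=; first by rewrite nth_nil.
rewrite iotaD map_cat count_cat add0n -[X in iota X (sumn a)]addn0 iotaDl -map_comp.
have -> : [seq reshape_index (x :: a) i | i <- iota 0 x] = nseq x 0.
  set l := map _ _; have szl : size l = x by rewrite size_map size_iota.
  rewrite -[X in nseq X]szl; apply/all_pred1P; rewrite all_map.
  apply/allP => i; rewrite mem_iota /= => lt_ix.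
  by rewrite reshape_index_cons lt_ix.
have -> : [seq (reshape_index (x :: a) \o addn x) i | i <- iota 0 (sumn a)] =
    [seq i.+1 | i <- [seq reshape_index a i | i <- iota 0 (sumn a)]].
  rewrite -map_comp; apply: eq_map => i /=.
  by rewrite reshape_index_cons ltnNge leq_addr addKn.
rewrite count_nseq count_map; case: j => [|j] /=; last by rewrite mul0n -IHa; apply: eq_count.
by rewrite mul1n (eq_count (a2 := pred0)) // count_pred0 addn0.
Qed.

Lemma reshape_sortedP b w : size w = sumn b -> reflect
  (forall i j, i < j < size w -> reshape_index b i = reshape_index b j ->
    nth 0 w i <= nth 0 w j)
  (all (sorted leq) (reshape b w)).
Proof.
elim: b w => [|x b IHb] w /= sz; first by left=> i j; rewrite sz ltn0 andbF.
have szt : size (take x w) = x by rewrite size_takel // sz leq_addr.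
have szd : size (drop x w) = sumn b by rewrite size_drop sz addKn.
apply: (iffP andP) => [[srt /(IHb _ szd) srts] i j /andP[lt_ij lt_j]|mono].
  rewrite !reshape_index_cons; case: (ltnP i x) => [lt_ix|le_xi].
    case: ltnP => // lt_jx _.
    rewrite -(nth_take 0 lt_ix) -(nth_take 0 lt_jx).
    by apply: (sorted_leq_nth leq_trans leqnn) => //; rewrite ?inE ?szt // ltnW.
  case: ltnP => // le_xj [/srts]; rewrite !nth_drop !subnKC //; apply.
  by rewrite szd; apply/andP; split; lia.
split.
  apply/(sortedP 0) => i; rewrite szt => lt_i; rewrite !nth_take ?(ltnW lt_i) //.
  by apply: mono; rewrite ?reshape_index_cons ?(ltnW lt_i) ?lt_i // sz; lia.
apply/(IHb _ szd) => i j; rewrite szd => /andP[lt_ij lt_j] eq_ij.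
rewrite !nth_drop; apply: mono; first by rewrite sz ltn_add2l lt_ij ltn_add2l.
by rewrite !reshape_index_cons !ltnNge !leq_addr !addKn eq_ij.
Qed.

End ReshapeIndex.

Section DoubleCosets.
Variables (n : nat) (b a : seq nat).
Hypotheses (bn : sumn b = n) (an : sumn a = n).
Local Open Scope nat_scope.
Local Open Scope group_scope.
Implicit Types (s t r : 'S_n) (c : {set 'S_n}).

Definition perm_word s := [seq reshape_index a (s i) | i : 'I_n].

Lemma winv_enum (f : 'I_n -> nat) :
  winv [seq f i | i : 'I_n] = #|[set p : 'I_n * 'I_n | (p.1 < p.2)%N && (f p.2 < f p.1)%N]|.
Proof.
have winv_map (l : seq 'I_n) : sorted (fun i j : 'I_n => i < j)%N l ->
    winv [seq f i | i <- l] = (\sum_(i <- l) \sum_(j <- l | (i < j)%N) (f j < f i)%N)%N.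
  elim: l => [|x l IHl] /=; first by rewrite big_nil.
  have tr : transitive (fun i j : 'I_n => i < j)%N by move=> i j k; apply: ltn_trans.
  rewrite (path_sortedE tr) => /andP[x_min /IHl ->].
  rewrite big_cons big_cons ltnn; congr (_ + _)%N.
    rewrite count_map -sum1_count big_mkcond /= [RHS]big_seq_cond [LHS]big_seq_cond.
    rewrite [LHS]big_mkcondr [RHS]big_mkcondr -big_seq -[RHS]big_seq.
    apply: eq_big_seq => j /(allP x_min) -> /=; by case: (_ < _)%N.
  by apply: eq_big_seq => i il; rewrite big_cons ltnNge (ltnW (allP x_min _ il)).
rewrite winv_map; last first.
  by have := iota_ltn_sorted 0 n; rewrite -val_enum_ord sorted_map.
rewrite big_enum /= -sum1_card [RHS]big_mkcond /=.
pose F (i j : 'I_n) := if (i < j)%N && (f j < f i)%N then 1%N else 0%N.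
transitivity (\sum_p F p.1 p.2)%N; last by apply: eq_bigr => p _; rewrite inE.
rewrite -(pair_bigA _ F) /=; apply: eq_bigr => i _.
rewrite big_enum_cond big_mkcond /=.
by apply: eq_bigr => j _; rewrite /F; do 2?case: ltnP.
Qed.

Lemma youngP (d : seq nat) s :
  reflect (forall i : 'I_n, reshape_index d (s i) = reshape_index d i) (s \in young n d).
Proof. by rewrite inE; apply: (iffP forallP) => s_d i; apply/eqP/s_d. Qed.

Lemma young_group_set (d : seq nat) : group_set (young n d).
Proof.
apply/group_setP; split=> [|s t /youngP s_d /youngP t_d].
  by apply/youngP => i; rewrite perm1.
by apply/youngP => i; rewrite permM t_d s_d.
Qed.
Canonical young_group d := Group (young_group_set d).

Lemma double_coset_eq c s : c \in double_cosets n b a -> s \in c ->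
  c = young n b * [set s] * young n a.
Proof.
move=> /imsetP[t _ ->] /mulsgP[_ z /mulsgP[y _ yb /set1P -> ->] za ->].
rewrite -!mulg_set1 !mulgA (rcoset_id yb) -(mulgA _ [set z]).
by rewrite (lcoset_id za).
Qed.

Lemma mem_double_coset s : s \in young n b * [set s] * young n a.
Proof.
by apply/mulsgP; exists s 1; rewrite ?mulg1 //; apply/mulsgP; exists 1 s;
  rewrite ?mul1g ?set11.
Qed.

(** A descent of [t] between neighbours in one block could be undone by a transposition from
    [young n d], which would shorten [t]. *)
Lemma length_min_increasing (d : seq nat) t :
  (forall r, r \in young n d -> (coxeter_length t <= coxeter_length (r * t))%N) ->
  forall i j : 'I_n, (i < j)%N -> reshape_index d i = reshape_index d j -> (t i < t j)%N.
Proof.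
move=> t_min; have step (i j : 'I_n) : j = i.+1 :> nat ->
    reshape_index d i = reshape_index d j -> (t i < t j)%N.
  move=> ij eq_ij; rewrite ltnNge leq_eqVlt.
  apply/negP => /orP[/eqP/val_inj/perm_inj ji|lt_t]; first by move: ij; rewrite ji; lia.
  have /t_min : tperm i j \in young n d.
    by apply/youngP => l; case: tpermP => [->|->|].
  rewrite !coxeter_lengthE.
  have := @inversions_ascent n i j (tperm i j * t) ij.
  rewrite !permM tpermL tpermR mulgA tperm2 mul1g => /(_ lt_t) ->.
  by rewrite ltnn.
(* Indices between two members of a block stay in that block, by monotonicity of [reshape_index], so
   the adjacent steps chain. *)
have inc m (i j : 'I_n) : j = (i + m).+1 :> nat ->
    reshape_index d i = reshape_index d j -> (t i < t j)%N.
  elim: m j => [|m IHm] j ij eq_ij; first by apply: step; rewrite // ij addn0.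
  have lt_n : ((i + m).+1 < n)%N by have := ltn_ord j; lia.
  have eq_l : reshape_index d i = reshape_index d (i + m).+1.
    by apply/eqP; rewrite eqn_leq {2}eq_ij !leq_reshape_index //; lia.
  apply: ltn_trans (IHm (Ordinal lt_n) _ eq_l) (step _ _ _ _) => //=.
    by rewrite ij addnS.
  by rewrite -eq_l.
by move=> i j lt_ij; apply: (inc (j - i.+1)%N); lia.
Qed.

Definition min_elt c := [arg min_(s < fingroup.repr c in c) coxeter_length s].

Lemma min_eltP c s : s \in c -> [/\ min_elt c \in c, min_length c = coxeter_length (min_elt c) &
  forall t, t \in c -> (coxeter_length (min_elt c) <= coxeter_length t)%N].
Proof.
move=> /mem_repr rc; rewrite /min_length /min_elt.
by case: arg_minnP => // t tc t_min; split.
Qed.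

Section MinimalElement.
Variables c : {set 'S_n}.
Hypothesis c_coset : c \in double_cosets n b a.
Let t := min_elt c.

Let c_t : c = young n b * [set t] * young n a.
Proof.
have [s _ c_s] := imsetP c_coset.
have [|tc _ _] := @min_eltP c s; first by rewrite c_s mem_double_coset.
exact: double_coset_eq.
Qed.

Let t_min u : u \in c -> (coxeter_length t <= coxeter_length u)%N.
Proof. by move=> uc; have [_ _] := min_eltP uc; apply. Qed.

Lemma min_elt_increasing (i j : 'I_n) : (i < j)%N ->
  reshape_index b i = reshape_index b j -> (t i < t j)%N.
Proof.
apply: length_min_increasing => r rb; apply: t_min; rewrite c_t.
by rewrite -[r * t]mulg1 mem_mulg ?group1 // mem_mulg ?set11.
Qed.

(** Passing to the inverse keeps the length and turns the right factor [young n a] into a left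
    one. *)
Lemma min_eltV_increasing (i j : 'I_n) : (i < j)%N ->
  reshape_index a i = reshape_index a j -> (t^-1 i < t^-1 j)%N.
Proof.
apply: length_min_increasing => r ra; rewrite -[r]invgK -invMg !coxeter_lengthV.
by apply: t_min; rewrite c_t mem_mulg ?groupV // -[t in t \in _]mul1g mem_mulg ?set11 ?group1.
Qed.

(** An inversion of [t] between two values of one [a]-block would contradict [min_eltV_increasing];
    hence replacing values by their blocks loses no inversion. *)
Lemma min_length_winv : min_length c = winv (perm_word t).
Proof.
have tc : t \in c by rewrite c_t mem_double_coset.
have [_ -> _] := min_eltP tc; rewrite coxeter_lengthE winv_enum.
apply: eq_card => -[i j]; rewrite !inE /=; apply: andb_id2l => lt_ij.
apply/idP/idP => [lt_t|]; last first.
  by rewrite !ltnNge; apply: contra; apply: leq_reshape_index.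
have := leq_reshape_index a (ltnW lt_t); rewrite leq_eqVlt => /orP[/eqP eq_a|//].
by have := min_eltV_increasing lt_t eq_a; rewrite !permK ltnNge (ltnW lt_ij).
Qed.

Lemma nth_perm_word s (i : 'I_n) : nth 0 (perm_word s) i = reshape_index a (s i).
Proof. by rewrite (nth_map i) ?size_enum_ord // nth_ord_enum. Qed.

Lemma perm_word_perm s : perm_eq (perm_word s) [seq reshape_index a i | i : 'I_n].
Proof.
pose f (i : 'I_n) := reshape_index a i.
rewrite -[perm_word s]/(map (f \o s) (enum 'I_n)) map_comp; apply: perm_map.
apply: uniq_perm => [||i]; rewrite ?enum_uniq ?(map_inj_uniq perm_inj) ?enum_uniq //.
by rewrite mem_enum; apply/mapP; exists (s^-1 i); rewrite ?mem_enum ?permKV.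
Qed.

Lemma size_perm_word s : size (perm_word s) = n.
Proof. by rewrite size_map size_enum_ord. Qed.

Lemma perm_word_min_elt : perm_word t \in words b a.
Proof.
apply/wordsP; rewrite bn size_perm_word; split=> // [j|].
  rewrite (seq.permP (perm_word_perm t)) -[in RHS]count_reshape_index an.
  by rewrite -val_enum_ord -map_comp.
apply/reshape_sortedP; rewrite size_perm_word // => i j /andP[lt_ij lt_j].
have lt_i := ltn_trans lt_ij lt_j.
move=> eq_b; rewrite (nth_perm_word _ (Ordinal lt_i)) (nth_perm_word _ (Ordinal lt_j)).
by apply/leq_reshape_index/ltnW/min_elt_increasing.
Qed.

End MinimalElement.

Lemma min_elt_mem c : c \in double_cosets n b a -> min_elt c \in c.
Proof.
move=> /imsetP[s _ c_s]; have [|//] := @min_eltP c s.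
by rewrite c_s mem_double_coset.
Qed.

(** Equal words mean that the two minimal elements differ by a factor in [young n a], so they share
    a double coset. *)
Lemma perm_word_inj c c' : c \in double_cosets n b a -> c' \in double_cosets n b a ->
  perm_word (min_elt c) = perm_word (min_elt c') -> c = c'.
Proof.
move=> cD cD'; set t := min_elt c; set t' := min_elt c' => eq_w.
have eq_a i : reshape_index a (t i) = reshape_index a (t' i).
  by rewrite -!nth_perm_word eq_w.
have tu : t^-1 * t' \in young n a.
  by apply/youngP => i; rewrite permM -eq_a permKV.
have t'c : t' \in c.
  by rewrite (double_coset_eq cD (min_elt_mem cD)) -[t'](mulKVg t) mem_mulg // -[t]mul1g
    mem_mulg ?group1 ?set11 // mul1g set11.
by rewrite (double_coset_eq cD t'c) -(double_coset_eq cD' (min_elt_mem cD')).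
Qed.

(* Permuting letters inside the blocks cannot change a word that is sorted on
   each block both before and after. *)
Lemma block_sorted_eq (d : seq nat) (f : 'I_n -> nat) y : y \in young n d ->
  (forall i j : 'I_n, (i < j)%N -> reshape_index d i = reshape_index d j ->
    (f i <= f j)%N) ->
  (forall i j : 'I_n, (i < j)%N -> reshape_index d i = reshape_index d j ->
    (f (y i) <= f (y j))%N) ->
  forall i, f (y i) = f i.
Proof.
move=> /youngP y_d f_srt fy_srt i.
pose l := [seq j : 'I_n <- enum 'I_n | reshape_index d j == reshape_index d i].
have l_srt (g : 'I_n -> nat) : (forall i j : 'I_n, (i < j)%N ->
    reshape_index d i = reshape_index d j -> (g i <= g j)%N) -> sorted leq (map g l).
  move=> g_srt; rewrite sorted_map.
  apply: (@sub_in_sorted _ [pred j : 'I_n | reshape_index d j == reshape_index d i]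
    (fun j j' : 'I_n => j < j')%N).
  - by move=> j j' /eqP ej /eqP ej' lt_j; apply: g_srt; rewrite // ej ej'.
  - by apply/allP => j; rewrite mem_filter => /andP[].
  apply: sorted_filter; first by move=> j j' j''; apply: ltn_trans.
  by have := iota_ltn_sorted 0 n; rewrite -val_enum_ord sorted_map.
have : map (f \o y) l = map f l.
  apply: (sorted_eq leq_trans anti_leq); rewrite ?(l_srt (f \o y)) ?l_srt //.
  rewrite map_comp; apply: perm_map; apply: uniq_perm.
  - by rewrite (map_inj_uniq perm_inj) filter_uniq ?enum_uniq.
  - by rewrite filter_uniq ?enum_uniq.
  move=> j; rewrite mem_filter mem_enum andbT; apply/mapP/idP => [[j' + ->]|j_i].
    by rewrite mem_filter y_d mem_enum andbT.
  exists (y^-1 j); last by rewrite permKV.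
  by rewrite mem_filter mem_enum andbT -y_d permKV.
by move=> /eq_in_map/(_ i) /=; apply; rewrite mem_filter eqxx mem_enum.
Qed.

(** The content of [w] makes it the word of some [s]. The minimal element of the coset of [s] is a
    product y s z: the factor z does not change [a]-blocks, and y only permutes letters inside
    [b]-blocks, where the words before and after are both sorted. So its word is still [w]. *)
Lemma perm_word_surj w : w \in words b a ->
  exists2 c, c \in double_cosets n b a & w = perm_word (min_elt c).
Proof.
move=> /wordsP[]; rewrite bn => sz w_a /reshape_sortedP; rewrite bn => /(_ sz) w_srt.
have : perm_eq w (perm_word 1).
  apply/allP => j _ /=; rewrite w_a -count_reshape_index an -val_enum_ord -map_comp.
  by apply/eqP/congr1/eq_map => i /=; rewrite perm1.
have szw : size (perm_word 1) == n by rewrite size_perm_word.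
rewrite -[perm_word 1]/(tval (Tuple szw)) => /tuple_permP[s w_s].
have {}w_s : w = perm_word s.
  rewrite w_s; apply: eq_map => i.
  by rewrite (tnth_nth 0) /= nth_perm_word perm1.
set c := young n b * [set s] * young n a.
have cD : c \in double_cosets n b a by apply: imset_f.
exists c => //; have := min_elt_mem cD; set t := min_elt c.
move=> /mulsgP[_ z /mulsgP[y _ yb /set1P -> ->] za t_s].
have t_a i : reshape_index a (t i) = reshape_index a (s (y i)).
  by rewrite t_s !permM (youngP _ _ za).
rewrite w_s; apply: eq_map => i; rewrite t_a; apply/esym.
apply: (block_sorted_eq (f := fun i => reshape_index a (s i)) yb) => j j' lt_j eq_j.
  have := w_srt j j'; rewrite w_s !nth_perm_word size_perm_word; apply=> //.
  by rewrite lt_j /=.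
by rewrite -!t_a; apply/leq_reshape_index/ltnW/min_elt_increasing.
Qed.

Lemma sum_double_cosets (R : pzRingType) :
  (\sum_(c in double_cosets n b a) (-1) ^+ min_length c = form_rec R b a)%R.
Proof.
rewrite form_rec_words (eq_bigr _ (fun c cD => congr1 _ (min_length_winv cD))).
rewrite -big_enum /= -(big_map (perm_word \o min_elt) xpredT (fun w => (-1) ^+ winv w)%R).
apply: perm_big; apply: uniq_perm => [| |w]; rewrite ?words_uniq //.
  rewrite map_inj_in_uniq ?enum_uniq // => c c'; rewrite !mem_enum.
  exact: perm_word_inj.
apply/mapP/idP => [[c cD ->]|/perm_word_surj[c cD ->]].
  by rewrite mem_enum in cD; apply: perm_word_min_elt.
by exists c; rewrite ?mem_enum.
Qed.
End DoubleCosets.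

Lemma form_wordE (k : fieldType) b a : form_word k b a = form_rec k b a.
Proof.
rewrite /form_word; case: eqP => [ba|/eqP/form_rec_neq -> //].
exact: sum_double_cosets.
Qed.

(* These maps are locked because unification would otherwise unfold monoid
   algebra products. *)
HB.lock Definition sgnf (k : fieldType) (m : nat) (x : {malg k[{fmonom nat}]}) :
    {malg k[{fmonom nat}]} :=
  linext (fun w : {fmonom nat} => (-1) ^+ (m * deg w) *: << w >>) x.
HB.lock Definition tproj (k : fieldType) (p : nat) (t : freeTens k) :
    {malg k[{fmonom nat}]} :=
  linext (fun q : {fmonom nat} * {fmonom nat} => (deg q.1 == p)%:R *: << q.2 >>) t.
HB.lock Definition perp (k : fieldType) (p : nat) (x : {malg k[{fmonom nat}]}) :
    {malg k[{fmonom nat}]} := tproj p (comultf x).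
Arguments sgnf {k} m x.
Arguments tproj {k} p t.
Arguments perp {k} p x.

(** * Skewing operators and their adjunction with multiplication *)

Section FreeAlgebra.
Variable k : fieldType.
Local Notation word := {fmonom nat}.
Local Notation L := {malg k[{fmonom nat}]}.
Local Notation T := (freeTens k).
Implicit Types (x y z : L) (u v w : word) (p n : nat).

Lemma word_ind (P : word -> Prop) :
  P 1%M -> (forall i w, P w -> P (fmu i * w)%M) -> forall w, P w.
Proof.
move=> P1 PM [w]; elim: w => [|i w IHw].
  by suff -> : FMonom [::] = 1%M :> word by []; apply/val_inj; rewrite /= fm1.
suff -> : FMonom (i :: w) = (fmu i * FMonom w)%M :> word by apply: PM.
by apply/val_inj; rewrite /= fmM fmU.
Qed.

Lemma malgUM u v : << u >> * << v >> = << (u * v)%M >> :> L.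
Proof. by rewrite -[LHS]/(fgmul << u >> << v >>) fgmulUU mulr1. Qed.

Lemma freeSym_scalerAr a x y : a *: (x * y) = x * (a *: y).
Proof.
have comm z : z * a%:MP = a%:MP * z.
  rewrite !malgM_def fgmulgU fgmulUg; apply: eq_bigr => u _.
  by rewrite mulm1 mul1m mulrC.
by rewrite -!mul_malgC mulrA -comm mulrA.
Qed.

Lemma mul_linearl y : linear (fun x => x * y).
Proof. by move=> a u v; rewrite mulrDl -scalerAl. Qed.

Lemma mul_linearr x : linear (fun y => x * y).
Proof. by move=> a u v; rewrite mulrDr freeSym_scalerAr. Qed.

Definition hword n : word := if n is i.+1 then fmu i else 1%M.

Lemma hgenE n : hgen k n = << hword n >>.
Proof. by case: n. Qed.

Lemma deg_hword n : deg (hword n) = n.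
Proof. by case: n => [|n]; rewrite ?deg1 // /deg /parts fmU /= addn0. Qed.

Lemma parts1 : parts 1%M = [::].
Proof. by rewrite /parts fm1. Qed.

Lemma partsM u v : parts (u * v)%M = parts u ++ parts v.
Proof. by rewrite /parts fmM map_cat. Qed.

Lemma partsU i : parts (fmu i) = [:: i.+1].
Proof. by rewrite /parts fmU. Qed.

Lemma hprod_nil : hprod k [::] = 1.
Proof. by rewrite /hprod big_nil. Qed.

Lemma hprod_cons n a : hprod k (n :: a) = hgen k n * hprod k a.
Proof. by rewrite /hprod big_cons. Qed.

Lemma malgU_hprod w : << w >> = hprod k (parts w).
Proof.
elim/word_ind: w => [|i w IHw]; first by rewrite parts1 hprod_nil.
by rewrite -malgUM IHw partsM partsU hprod_cons.
Qed.

Lemma sgnf_is_linear m : linear (@sgnf k m).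
Proof. by rewrite sgnf.unlock; apply: linext_is_linear. Qed.
HB.instance Definition _ m := GRing.isLinear.Build k L L _ (@sgnf k m) (sgnf_is_linear m).

Lemma sgnfU m w : sgnf m << w >> = (-1) ^+ (m * deg w) *: << w >> :> L.
Proof. by rewrite sgnf.unlock linext1. Qed.

Lemma tproj_is_linear p : linear (@tproj k p).
Proof. by rewrite tproj.unlock; apply: linext_is_linear. Qed.
HB.instance Definition _ p := GRing.isLinear.Build k T L _ (@tproj k p) (tproj_is_linear p).

Lemma tprojU p u v : tproj p (<< (u, v) >> : T) = (deg u == p)%:R *: << v >>.
Proof. by rewrite tproj.unlock linext1. Qed.

(** The first factor of [Y] has degree p - r and must pass the second factor of [X]; [sgnf (p - r)]
    records the resulting sign. *)
Lemma tprojM p (X Y : T) :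
  tproj p (X * Y) = \sum_(r < p.+1) sgnf (p - r) (tproj r X) * tproj (p - r) Y.
Proof.
move: X; apply: malg_lin_ext.
- exact: linear_fun_comp (tproj_is_linear p) (tmul_linearl Y).
- move=> a X X'; rewrite scaler_sumr -big_split /=; apply: eq_bigr => r _.
  by rewrite !linearP mulrDl -scalerAl.
move=> [u u']; move: Y; apply: malg_lin_ext.
- exact: linear_fun_comp (tproj_is_linear p) (tmul_linearr _).
- move=> a Y Y'; rewrite scaler_sumr -big_split /=; apply: eq_bigr => r _.
  by rewrite !linearP mulrDr -freeSym_scalerAr.
move=> [v v']; rewrite -[X in tproj _ X]/(tmul << (u, u') >> << (v, v') >>).
rewrite tmulU /tmul_word linearZ /= tprojU degM.
under eq_bigr => r _ do
  rewrite !tprojU linearZ /= sgnfU -scalerAl -scalerAl -freeSym_scalerAr malgUM.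
have [lt_p|lt_p] := ltnP p (deg u).
  rewrite gtn_eqF ?ltn_addr // scale0r scaler0 big1 // => r _.
  by rewrite gtn_eqF ?scale0r // (leq_trans (ltn_ord r)).
rewrite (bigD1 (Ordinal (lt_p : (deg u < p.+1)%N))) //= big1 ?addr0 => [|r].
  rewrite eqxx scale1r; have -> : (deg u + deg v == p) = (deg v == p - deg u)%N.
    by apply/eqP/eqP; lia.
  case: eqP => [e|_]; last by rewrite !(scale0r _ : false%:R *: _ = _) !scaler0.
  by rewrite -e mulnC.
by rewrite -val_eqE /= eq_sym => /negbTE ->; rewrite scale0r.
Qed.

Lemma perp_is_linear p : linear (@perp k p).
Proof.
rewrite perp.unlock; exact: linear_fun_comp (tproj_is_linear p) (@comultf_is_linear k).
Qed.
HB.instance Definition _ p := GRing.isLinear.Build k L L _ (@perp k p) (perp_is_linear p).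

Lemma perpM p x y :
  perp p (x * y) = \sum_(r < p.+1) sgnf (p - r) (perp r x) * perp (p - r) y.
Proof. by rewrite perp.unlock comultfM tprojM. Qed.

Lemma perp_h p n : perp p (hgen k n) = if (p <= n)%N then hgen k (n - p) else 0.
Proof.
rewrite perp.unlock comultf_h /comult_gen linear_sum /=.
under eq_bigr => m _ do rewrite !hgenE tensfU tprojU deg_hword.
case: leqP => [le_pn|lt_np]; last first.
  by rewrite big1 // => m _; rewrite ltn_eqF ?scale0r // (leq_trans (ltn_ord m)).
rewrite (bigD1 (Ordinal (le_pn : (p < n.+1)%N))) //= eqxx scale1r big1 ?addr0 ?hgenE //.
by move=> m; rewrite -val_eqE => /negbTE /= ->; rewrite scale0r.
Qed.

Lemma perp1 p : perp p 1 = (p == 0%N)%:R :> L.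
Proof. by rewrite -[1]/(hgen k 0) perp_h leqn0; case: eqP => // ->. Qed.

(** Here [c] lists how much the skewing removes from each part. What is removed from later parts
    passes what remains of earlier ones, which gives the exponent [cross]; these are the summands of
    [form_rec]. *)
Lemma perp_hprod p a : perp p (hprod k a) =
  \sum_(c <- splits p a) (-1) ^+ cross c (seq_sub a c) *: hprod k (seq_sub a c).
Proof.
elim: a p => [|n a IHa] p.
  rewrite hprod_nil perp1 /=; case: eqP; last by rewrite big_nil.
  by rewrite big_seq1 expr0 scale1r hprod_nil.
rewrite hprod_cons perpM splits_cons big_allpairs_dep /=.
rewrite /split_heads big_filter -[iota _ _]/(index_iota 0 p.+1) big_mkord.
rewrite [RHS]big_mkcond; apply: eq_bigr => r _; rewrite perp_h.
case: ifP => [_|_]; last by rewrite linear0 mul0r.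
rewrite IHa hgenE sgnfU deg_hword mulr_sumr; apply: eq_big_seq => c.
rewrite mem_splits => /and3P[_ _ /eqP c_sum]; rewrite /seq_sub /= hprod_cons c_sum.
by rewrite -scalerAl -freeSym_scalerAr scalerA -exprD mulnC hgenE.
Qed.

Lemma perp0id x : perp 0 x = x.
Proof.
move: x; apply: malg_lin_ext; [exact: perp_is_linear | by [] | move=> w].
elim/word_ind: w => [|i w IHw]; first by rewrite perp1.
rewrite -malgUM perpM big_ord_recl big_ord0 addr0 subnn IHw.
rewrite -[<< fmu i >>]/(hgen k i.+1) perp_h subn0 hgenE sgnfU mul0n scale1r.
by [].
Qed.

Lemma hprodU a : exists2 w, hprod k a = << w >> & deg w = sumn a.
Proof.
elim: a => [|n a [w a_w wa]]; first by exists 1%M; rewrite ?hprod_nil ?deg1.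
exists (hword n * w)%M; last by rewrite degM deg_hword wa.
by rewrite hprod_cons a_w hgenE malgUM.
Qed.

Lemma deg_eq0 w : (deg w == 0%N) = (w == 1%M).
Proof.
elim/word_ind: w => [|i w _]; first by rewrite deg1 !eqxx.
by rewrite degM -[fmu i]/(hword i.+1) deg_hword fmM_eq1 fm1_eq1.
Qed.

Fixpoint perps (b : seq nat) (x : L) : k :=
  if b is p :: b' then perps b' (perp p x) else x@_1%M.

Lemma perps_is_linear b : linear (perps b : L -> k^o).
Proof.
elim: b => [|p b IHb] a x y /=; first by rewrite mcoeffD mcoeffZ.
by rewrite linearP IHb.
Qed.
HB.instance Definition _ b :=
  GRing.isLinear.Build k L k^o _ (perps b : L -> k^o) (perps_is_linear b).

Lemma perps_hprod b a : perps b (hprod k a) = form_rec k b a.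
Proof.
elim: b a => [|p b IHb] a /=.
  have [w -> <-] := hprodU a; by rewrite mcoeffU deg_eq0.
rewrite perp_hprod (linear_sum (perps b : L -> k^o)) /=; apply: eq_bigr => c _.
by rewrite linearZ /= IHb.
Qed.

Lemma formfUl u x : formf << u >> x = perps (parts u) x.
Proof.
move: x; apply: (@malg_lin_ext _ _ k^o).
- exact: formf_linearr.
- exact: perps_is_linear.
move=> v; rewrite /formf !linext1 form_wordE malgU_hprod perps_hprod //.
Qed.

Lemma formf_hM p x y : formf (hgen k p * x) y = formf x (perp p y).
Proof.
move: x; apply: (@malg_lin_ext _ _ k^o).
- apply: (linear_fun_comp (f := fun x : L => formf x y : k^o)) (mul_linearr _).
  exact: formf_linearl.
- exact: formf_linearl.
move=> u; case: p => [|i]; first by rewrite mul1r perp0id.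
by rewrite malgUM !formfUl partsM partsU.
Qed.

End FreeAlgebra.

(** * Adjunction of product and coproduct; the radical is an ideal *)

HB.lock Definition pairT (k : fieldType) (t : freeTens k) (x y : {malg k[{fmonom nat}]}) : k :=
  linext (V := k^o)
    (fun q : {fmonom nat} * {fmonom nat} => formf << q.1 >> x * formf << q.2 >> y) t.
Arguments pairT {k} t x y.

Section Adjunction.
Variable k : fieldType.
Local Notation word := {fmonom nat}.
Local Notation L := {malg k[{fmonom nat}]}.
Local Notation T := (freeTens k).
Implicit Types (x y z : L) (t : T) (u v w : word) (p n d : nat).

Lemma formf_neq_deg u v : deg u != deg v -> formf << u >> << v >> = 0 :> k.
Proof. by rewrite formfUl malgU_hprod perps_hprod => /form_rec_neq ->. Qed.

Lemma formf_sgnf n u x : formf << u >> (sgnf n x) = (-1) ^+ (n * deg u) * formf << u >> x.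
Proof.
move: x; apply: (@malg_lin_ext _ _ k^o).
- apply: (linear_fun_comp (f := formf << u >> : L -> k^o)); last exact: sgnf_is_linear.
  exact: formf_linearr.
- move=> a x y; rewrite formf_linearr mulrDr; congr (_ + _); exact: mulrCA.
move=> v; rewrite sgnfU (linear_funZ _ _ (@formf_linearr k << u >>)) /=.
have [->//|neq] := eqVneq (deg u) (deg v).
by rewrite formf_neq_deg // scaler0 mulr0.
Qed.

Lemma pairT_is_linear x y : linear (fun t : T => pairT t x y : k^o).
Proof. by rewrite pairT.unlock; apply: linext_is_linear. Qed.

Lemma pairTU u v x y :
  pairT (<< (u, v) >> : T) x y = formf << u >> x * formf << v >> y.
Proof. by rewrite pairT.unlock linext1. Qed.

Lemma pairT_tensf x' y' x y : pairT (tensf x' y') x y = formf x' x * formf y' y.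
Proof.
move: x'; apply: (@malg_lin_ext _ _ k^o).
- apply: (linear_fun_comp (f := fun t : T => pairT t x y : k^o)).
    exact: pairT_is_linear.
  exact: tensf_linearl.
- by move=> a u v; rewrite formf_linearl mulrDl; congr (_ + _); exact/esym/mulrA.
move=> u; move: y'; apply: (@malg_lin_ext _ _ k^o).
- apply: (linear_fun_comp (f := fun t : T => pairT t x y : k^o)).
    exact: pairT_is_linear.
  exact: tensf_linearr.
- by move=> a u' v; rewrite formf_linearl mulrDr; congr (_ + _); exact: mulrCA.
by move=> v; rewrite tensfU pairTU.
Qed.

Lemma formf_hwordM p u x : formf << (hword p * u)%M >> x = formf << u >> (perp p x).
Proof. by rewrite -formf_hM hgenE malgUM. Qed.

(** The sign of moving h_n past the first factor depends on the degree of that factor. As the form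
    vanishes between different degrees, the sign can be placed on the skewed [x]. *)
Lemma pairT_hM m n t x y : pairT (tensf (hgen k m) (hgen k n) * t) x y =
  pairT t (sgnf n (perp m x)) (perp n y).
Proof.
move: t; apply: (@malg_lin_ext _ _ k^o).
- apply: (linear_fun_comp (f := fun t : T => pairT t x y : k^o)).
    exact: pairT_is_linear.
  exact: tmul_linearr.
- exact: pairT_is_linear.
move=> [u v]; rewrite !hgenE tensfU.
rewrite -[X in pairT X]/(tmul << (hword m, hword n) >> << (u, v) >>) tmulU /tmul_word.
have pairZ a s : pairT (a *: s) x y = a * pairT s x y.
  exact: (linear_funZ a s (pairT_is_linear x y)).
rewrite pairZ pairTU pairTU /= (formf_hwordM m u x) (formf_hwordM n v y) deg_hword.
by rewrite (formf_sgnf n u (perp m x)) -mulrA.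
Qed.

Lemma comultf1 : comultf (1 : L) = 1.
Proof. by rewrite /comultf linext1 parts1 big_nil. Qed.

Lemma formf1l x : formf 1 x = x@_1%M.
Proof. by rewrite formfUl parts1. Qed.

(** By induction on a word [z]: after its first generator is removed, the terms of the Leibniz rule
    for skewing x y match those that [pairT_hM] gives for the coproduct of that generator. *)
Lemma pairT_comultf z x y : pairT (comultf z) x y = formf z (x * y).
Proof.
move: z; apply: (@malg_lin_ext _ _ k^o).
- apply: (linear_fun_comp (f := fun t : T => pairT t x y : k^o)).
    exact: pairT_is_linear.
  exact: comultf_is_linear.
- exact: formf_linearl.
move=> w; elim/word_ind: w x y => [|i w IHw] x y.
  by rewrite comultf1 pairTU !formf1l rmorphM.
rewrite -malgUM -[<< fmu i >>]/(hgen k i.+1) formf_hM perpM comultfM comultf_h.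
rewrite /comult_gen mulr_suml.
have pair_sum (F : 'I_i.+2 -> T) :
    pairT (\sum_r F r) x y = \sum_r pairT (F r) x y.
  elim/big_rec2: _ => [|r c t _ <-].
    exact: (linear_fun0 (pairT_is_linear x y)).
  by have := pairT_is_linear x y 1 (F r) t; rewrite /= !scale1r.
rewrite pair_sum.
have form_sum (F : 'I_i.+2 -> L) :
    formf << w >> (\sum_r F r) = \sum_r formf << w >> (F r).
  elim/big_rec2: _ => [|r c t _ <-].
    exact: (linear_fun0 (@formf_linearr k << w >>)).
  by have := formf_linearr << w >> 1 (F r) t; rewrite /= !scale1r.
by rewrite form_sum; apply: eq_bigr => r _; rewrite pairT_hM IHw.
Qed.

Lemma radicalP x : reflect (forall y, formf x y = 0) (x \in radical k).
Proof. exact: asboolP. Qed.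

Lemma pairT_radical t x y :
  x \in radical k \/ y \in radical k -> pairT t x y = 0.
Proof.
move=> xy; move: t; apply: (@malg_lin_ext _ _ k^o).
- exact: pairT_is_linear.
- by move=> a t t'; rewrite scaler0 addr0.
move=> [u v]; rewrite pairTU formfC [X in _ * X]formfC.
by case: xy => /radicalP ->; rewrite ?mul0r ?mulr0.
Qed.

Lemma radicalM x y : x \in radical k \/ y \in radical k -> x * y \in radical k.
Proof.
by move=> xy; apply/radicalP => z; rewrite formfC -pairT_comultf pairT_radical.
Qed.

Lemma radical_words x : (forall w, formf << w >> x = 0) -> x \in radical k.
Proof.
move=> x0; apply/radicalP => y; rewrite formfC; move: y.
apply: (@malg_lin_ext _ _ k^o _ (fun=> 0)) => //; first exact: formf_linearl.
by move=> a t t'; rewrite scaler0 addr0.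
Qed.

End Adjunction.

(** * Primitive elements described by the form *)

Section Primitives.
Variable k : fieldType.
Local Notation word := {fmonom nat}.
Local Notation L := {malg k[{fmonom nat}]}.
Local Notation T := (freeTens k).
Implicit Types (x y z : L) (t : T) (u v w : word) (n : nat).

Lemma pairTD t t' x y : pairT (t + t') x y = pairT t x y + pairT t' x y.
Proof. by have := pairT_is_linear x y 1 t t'; rewrite /= !scale1r. Qed.

Lemma pairTZ a t x y : pairT (a *: t) x y = a * pairT t x y.
Proof. exact: (linear_funZ a t (pairT_is_linear x y)). Qed.

Lemma pairT0 x y : pairT (0 : T) x y = 0.
Proof. exact: (linear_fun0 (pairT_is_linear x y)). Qed.

Lemma pairT_sum (I : Type) (s : seq I) (F : I -> T) x y :
  pairT (\sum_(i <- s) F i) x y = \sum_(i <- s) pairT (F i) x y.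
Proof. by elim/big_rec2: _ => [|i c t _ <-]; rewrite ?pairT0 ?pairTD. Qed.

Lemma formfDl x x' y : formf (x + x') y = formf x y + formf x' y.
Proof. by have := formf_linearl y 1 x x'; rewrite /= !scale1r. Qed.

Lemma formfZl a x y : formf (a *: x) y = a * formf x y.
Proof. exact: (linear_funZ a x (@formf_linearl k y)). Qed.

Lemma formf0l y : formf (0 : L) y = 0.
Proof. exact: (linear_fun0 (@formf_linearl k y)). Qed.

Lemma formf_suml (I : Type) (s : seq I) (F : I -> L) y :
  formf (\sum_(i <- s) F i) y = \sum_(i <- s) formf (F i) y.
Proof. by elim/big_rec2: _ => [|i c t _ <-]; rewrite ?formf0l ?formfDl. Qed.

Lemma tensfDl x x' y : tensf (x + x') y = tensf x y + tensf x' y.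
Proof. by have := tensf_linearl y 1 x x'; rewrite /= !scale1r. Qed.

Lemma tensfDr x y y' : tensf x (y + y') = tensf x y + tensf x y'.
Proof. by have := tensf_linearr x 1 y y'; rewrite /= !scale1r. Qed.

Lemma tensfZl a x y : tensf (a *: x) y = a *: tensf x y.
Proof. exact: (linear_funZ a x (tensf_linearl y)). Qed.

Lemma tensfZr a x y : tensf x (a *: y) = a *: tensf x y.
Proof. exact: (linear_funZ a y (tensf_linearr x)). Qed.

Lemma tensf0r x : tensf x (0 : L) = 0.
Proof. exact: (linear_fun0 (tensf_linearr x)). Qed.

Lemma tensf_sumr (I : Type) (s : seq I) (F : I -> L) x :
  tensf x (\sum_(i <- s) F i) = \sum_(i <- s) tensf x (F i).
Proof. by elim/big_rec2: _ => [|i c t _ <-]; rewrite ?tensf0r ?tensfDr. Qed.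

Lemma tensf_radical x y : x \in radical k \/ y \in radical k ->
  tensf x y \in tens_radical k.
Proof.
move=> xy; apply/asboolP; exists [:: (1, tensf x y)].
by rewrite big_seq1 scale1r; split=> // p; rewrite inE => /eqP ->; exists x, y.
Qed.

Lemma freeTens_sum t : exists s : seq (L * L), t = \sum_(p <- s) tensf p.1 p.2.
Proof.
exists [seq (t@_q *: << q.1 >>, << q.2 >>) | q <- enum_fset (msupp t)].
rewrite big_map {1}[t]monalgE; apply: eq_bigr => -[u v] _ /=.
by rewrite tensfZl tensfU malgZU.
Qed.

(* If (x0, u) = c <> 0, pairing the first factors with u writes y0 modulo the
   radical in terms of the other y_i, which removes one summand. *)
Lemma sum_tensf_radical (s : seq (L * L)) :
  (forall x y, pairT (\sum_(p <- s) tensf p.1 p.2) x y = 0) ->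
  \sum_(p <- s) tensf p.1 p.2 \in tens_radical k.
Proof.
have [n] := ubnP (size s); elim: n s => // n IHn [|[x0 y0] s] /=.
  by rewrite big_nil rpred0.
rewrite ltnS => le_sn; rewrite big_cons /= => t0.
have [x0_rad|/negP x0_nrad] := boolP (x0 \in radical k).
  have /radicalP x0_0 := x0_rad.
  rewrite rpredD ?tensf_radical ?IHn //; first by left.
  move=> x y; have := t0 x y; rewrite pairTD pairT_tensf.
  by rewrite x0_0 mul0r add0r.
have [z x0z] : exists z, formf x0 z != 0.
  apply: contrapT => nex; apply: x0_nrad; apply/radicalP => z.
  by apply/eqP; apply: contrapT => /negP neq; apply: nex; exists z.
set c := formf x0 z in x0z.
pose s' := [seq (p.1 - (c^-1 * formf p.1 z) *: x0, p.2) | p <- s].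
pose y' := y0 + \sum_(p <- s) (c^-1 * formf p.1 z) *: p.2.
have y'_rad : y' \in radical k.
  apply/radicalP => v; have := t0 z v.
  rewrite pairTD pairT_tensf pairT_sum /y' formfDl formf_suml -/c => e.
  apply: (mulfI x0z); rewrite mulr0 -[RHS]e mulrDr mulr_sumr; congr (_ + _).
  by apply: eq_bigr => p _; rewrite formfZl pairT_tensf mulrA mulrA mulfV // mul1r.
have t_s' : tensf x0 y0 + \sum_(p <- s) tensf p.1 p.2 =
    tensf x0 y' + \sum_(p <- s') tensf p.1 p.2.
  rewrite /s' big_map /y' tensfDr -addrA; congr (_ + _).
  rewrite tensf_sumr -big_split; apply: eq_bigr => p _ /=.
  by rewrite -scaleNr tensfDl tensfZl tensfZr scaleNr addrCA subrr addr0.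
rewrite t_s' rpredD //; first by apply: tensf_radical; right.
apply: IHn => [|x y]; first by rewrite size_map.
have := t0 x y; rewrite t_s' pairTD pairT_tensf (elimT (radicalP y') y'_rad).
by rewrite mulr0 add0r.
Qed.

Lemma tens_radicalP t :
  t \in tens_radical k <-> forall x y, pairT t x y = 0.
Proof.
split=> [/asboolP[s [s_rad ->]] u v|t0].
  rewrite pairT_sum big_seq big1 // => p /s_rad[x [y [xy ->]]].
  rewrite pairTZ pairT_tensf.
  by case: xy => /radicalP ->; rewrite ?mul0r !mulr0.
by have [s t_s] := freeTens_sum t; rewrite t_s in t0 *; apply: sum_tensf_radical.
Qed.

Lemma formf1_word w : formf 1 << w >> = (w == 1%M)%:R :> k.
Proof. by rewrite formf1l mcoeffU. Qed.

Lemma oliftK (x : oddSym k) : osym (olift x) = x.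
Proof. exact: reprmodK. Qed.

Lemma primitiveE (x : oddSym k) : (x \in primitive k) =
  (comultf (olift x) - (tensf 1 (olift x) + tensf (olift x) 1) \in tens_radical k).
Proof.
rewrite -(projmodP (tens_radical k)) projmodD unfold_in /comult.
by rewrite -{2 3}(oliftK x) !tens_osym.
Qed.

(** Paired with y (x) y', primitivity reads (x, y y') = (1, y)(x, y') + (x, y)(1, y'). The right
    side vanishes when y and y' are both nonempty words. *)
Lemma primitiveP (x : oddSym k) : x \in primitive k <->
  forall w, size (parts w) != 1%N -> form x (osym << w >>) = 0.
Proof.
have formE y : form x (osym y) = formf (olift x) y by rewrite -[in LHS](oliftK x) form_osym.
set z := olift x in formE.
have pairE y y' : pairT (comultf z - (tensf 1 z + tensf z 1)) y y' =
    formf z (y * y') - (formf 1 y * formf z y' + formf z y * formf 1 y').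
  rewrite -scaleN1r pairTD pairTZ pairTD (pairT_tensf 1 z) (pairT_tensf z 1).
  by rewrite pairT_comultf mulN1r.
rewrite primitiveE tens_radicalP; split=> [prim w|prim y y'].
  rewrite formE => w1; have {}prim y y' : formf z (y * y') =
      formf 1 y * formf z y' + formf z y * formf 1 y'.
    by apply/eqP; rewrite -subr_eq0 -pairE prim.
  elim/word_ind: w w1 => [|i w _].
    (* With y = y' = 1 the identity reads (x, 1) = 2 (x, 1). *)
    have := prim 1 1; rewrite mulr1 (formf1_word 1%M) eqxx mul1r mulr1.
    by move/eqP; rewrite -subr_eq0 opprD addNKr oppr_eq0 => /eqP.
  rewrite partsM partsU -malgUM prim (formf1_word (fmu i)) fm1_eq1 mul0r add0r.
  have [->|wn1] := eqVneq w 1%M; first by rewrite parts1.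
  by rewrite formf1_word (negbTE wn1) mulr0.
rewrite pairE; apply/eqP; rewrite subr_eq0; apply/eqP.
have z1 : formf z 1 = 0 by rewrite -formE prim // parts1.
have lin y0 : linear (formf y0 : L -> k^o) by exact: formf_linearr.
move: y; apply: (@malg_lin_ext _ _ k^o).
- by apply: (linear_fun_comp (f := formf z : L -> k^o)); last exact: mul_linearl.
- move=> a u u'; rewrite !lin.
  have E (A B C D F G : k) :
    (a * A + B) * C + (a * D + F) * G = a * (A * C + D * G) + (B * C + F * G) by ring.
  exact: E.
move=> u; move: y'; apply: (@malg_lin_ext _ _ k^o).
- by apply: (linear_fun_comp (f := formf z : L -> k^o)); last exact: mul_linearr.
- move=> a v v'; rewrite !lin.
  have E (A B C D F G : k) :
    A * (a * B + C) + D * (a * F + G) = a * (A * B + D * F) + (A * C + D * G) by ring.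
  exact: E.
move=> v; rewrite !formf1_word malgUM.
have [->|un1] := eqVneq u 1%M.
  by rewrite mul1m mul1r z1 mul0r addr0.
have [->|vn1] := eqVneq v 1%M.
  by rewrite mulm1 mul0r mulr1 add0r.
rewrite mul0r mulr0 addr0 -formE prim // partsM size_cat.
have sz w : w != 1%M -> (0 < size (parts w))%N.
  by elim/word_ind: w => [|i w _]; rewrite ?eqxx // partsM partsU.
by have := sz u un1; have := sz v vn1; lia.
Qed.

End Primitives.

(** * A generating function for pairings with h_i h_j, and its symmetry *)

Section SumsOfPowers.
Variable R : comNzRingType.
Implicit Types s t : R.

(** The complete homogeneous polynomial of degree n - 1 in two variables; for n = 0 the sum is
    empty, so the truncated [n.-1] does no harm. *)
Definition hsum n s t : R := \sum_(i < n) s ^+ i * t ^+ (n.-1 - i).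

Lemma hsumC n s t : hsum n s t = hsum n t s.
Proof.
rewrite /hsum (reindex_inj rev_ord_inj) /=; apply: eq_bigr => i _.
by rewrite mulrC; congr (_ ^+ _ * _ ^+ _); have := ltn_ord i; lia.
Qed.

Lemma big_ord_double (F : nat -> R) n :
  \sum_(p < n.*2) F p = \sum_(i < n) F i.*2 + \sum_(i < n) F i.*2.+1.
Proof.
elim: n => [|n IHn]; first by rewrite !big_ord0 addr0.
by rewrite doubleS !big_ord_recr /= IHn; ring.
Qed.

(** In the application [f] sends e to [two_row s (e * t) w]. It sees only the parity of p, so the
    even and the odd p each sum to an [hsum] in the squares. *)
Lemma sum_powers_even n s t (f : R -> R) :
  \sum_(p < n.*2.+1) s ^+ p * t ^+ (n.*2 - p) * f ((-1) ^+ p) =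
  hsum n.+1 (s ^+ 2) (t ^+ 2) * f 1 + s * t * hsum n (s ^+ 2) (t ^+ 2) * f (-1).
Proof.
rewrite big_ord_recr /= (big_ord_double (fun p => s ^+ p * t ^+ (n.*2 - p) * f ((-1) ^+ p))).
rewrite /hsum [in RHS]big_ord_recr /= mulrDl [LHS]addrAC; congr (_ + _ + _).
- rewrite mulr_suml; apply: eq_bigr => i _; rewrite -!exprM -signr_odd odd_double expr0.
  by congr (_ ^+ _ * _ ^+ _ * _); have := ltn_ord i; lia.
- by rewrite -exprM -signr_odd odd_double !subnn mul2n !expr0.
rewrite mulr_sumr mulr_suml; apply: eq_bigr => i _; rewrite -!exprM -signr_odd /= odd_double expr1.
have -> : (n.*2 - i.*2.+1)%N = (2 * (n.-1 - i)).+1 by have := ltn_ord i; lia.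
by rewrite -muln2 mulnC !exprS; ring.
Qed.

Lemma sum_powers_odd n s t (f : R -> R) :
  \sum_(p < n.*2.+2) s ^+ p * t ^+ (n.*2.+1 - p) * f ((-1) ^+ p) =
  hsum n.+1 (s ^+ 2) (t ^+ 2) * (t * f 1 + s * f (-1)).
Proof.
rewrite -doubleS (big_ord_double (fun p => s ^+ p * t ^+ (n.*2.+1 - p) * f ((-1) ^+ p))).
rewrite mulrDr /hsum !mulr_suml; congr (_ + _); apply: eq_bigr => i _.
  have -> : (n.*2.+1 - i.*2)%N = (2 * (n.+1.-1 - i)).+1 by have := ltn_ord i; lia.
  by rewrite -!exprM -signr_odd odd_double expr0 -muln2 mulnC exprS; ring.
have -> : (n.*2.+1 - i.*2.+1)%N = (2 * (n.+1.-1 - i))%N by have := ltn_ord i; lia.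
by rewrite -!exprM -signr_odd /= odd_double expr1 -muln2 mulnC exprS; ring.
Qed.

End SumsOfPowers.

(* The coefficient of s^j t^i in two_row s t w is (h_w, h_i h_j). *)
HB.lock Definition teval (k : fieldType) (s t : {poly k}) (x : freeTens k) : {poly k} :=
  linext (fun q : {fmonom nat} * {fmonom nat} => s ^+ deg q.2 * t ^+ deg q.1) x.
Arguments teval {k} s t x.
Definition two_row (k : fieldType) (s t : {poly k}) (w : {fmonom nat}) : {poly k} :=
  teval s t (comultf << w >>).

Section Relations.
Variable k : fieldType.
Local Notation word := {fmonom nat}.
Local Notation L := {malg k[{fmonom nat}]}.
Local Notation T := (freeTens k).
Implicit Types (x y z : L) (X : T) (s t : {poly k}) (u v w : word) (n : nat).

Lemma teval_is_linear s t : linear (teval s t : T -> {poly k}).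
Proof. by rewrite teval.unlock; apply: linext_is_linear. Qed.
HB.instance Definition _ s t :=
  GRing.isLinear.Build k T {poly k} _ (teval s t) (teval_is_linear s t).

Lemma tevalU s t u v : teval s t (<< (u, v) >> : T) = s ^+ deg v * t ^+ deg u.
Proof. by rewrite teval.unlock linext1. Qed.

Lemma tens_hM m n u v : tensf (hgen k m) (hgen k n) * << (u, v) >> =
  (-1) ^+ (n * deg u) *: << ((hword m * u)%M, (hword n * v)%M) >> :> T.
Proof.
rewrite !hgenE tensfU -[LHS]/(tmul << (hword m, hword n) >> << (u, v) >>).
by rewrite tmulU /tmul_word /= deg_hword.
Qed.

(** The sign of h_n passing a first factor of degree d is (-1)^(n d), which the substitution of
    (-1)^n t for t produces. *)
Lemma teval_hM s t m n X : teval s t (tensf (hgen k m) (hgen k n) * X) =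
  s ^+ n * t ^+ m * teval s ((-1) ^+ n * t) X.
Proof.
move: X; apply: malg_lin_ext.
- apply: (linear_fun_comp (f := teval s t)); first exact: teval_is_linear.
  exact: tmul_linearr.
- by move=> a X Y; rewrite linearP /= mulrDr scalerAr.
move=> [u v]; rewrite tens_hM linearZ /= !tevalU !degM !deg_hword.
rewrite -signr_odd scaler_sign -mulr_sign signr_odd !exprD exprMn -exprM.
ring.
Qed.

Lemma two_row_cons s t a w : two_row s t (hword a * w)%M =
  \sum_(p < a.+1) s ^+ p * t ^+ (a - p) * two_row s ((-1) ^+ p * t) w.
Proof.
rewrite /two_row -malgUM -hgenE comultfM comultf_h /comult_gen mulr_suml.
rewrite linear_sum /= (reindex_inj rev_ord_inj) /=; apply: eq_bigr => p _.
by rewrite subSS subKn ?teval_hM // -ltnS.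
Qed.

Lemma two_row1 s t : two_row s t 1%M = 1.
Proof. by rewrite /two_row comultf1 tevalU deg1 !expr0 mulr1. Qed.

Lemma two_row_even s t n w : two_row s t (hword n.*2 * w)%M =
  hsum n.+1 (s ^+ 2) (t ^+ 2) * two_row s t w +
  s * t * hsum n (s ^+ 2) (t ^+ 2) * two_row s (- t) w.
Proof.
rewrite two_row_cons (sum_powers_even n s t (fun e => two_row s (e * t) w)).
by rewrite mul1r mulN1r.
Qed.

Lemma two_row_odd s t n w : two_row s t (hword n.*2.+1 * w)%M =
  hsum n.+1 (s ^+ 2) (t ^+ 2) * (t * two_row s t w + s * two_row s (- t) w).
Proof.
rewrite two_row_cons (sum_powers_odd n s t (fun e => two_row s (e * t) w)).
by rewrite mul1r mulN1r.
Qed.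

Lemma word_hword_ind (P : word -> Prop) : P 1%M ->
  (forall n w, P w -> P (hword n.*2 * w)%M) ->
  (forall n w, P w -> P (hword n.*2.+1 * w)%M) -> forall w, P w.
Proof.
move=> P1 Pe Po; elim/word_ind => // i w Pw; rewrite -[fmu i]/(hword i.+1).
by rewrite -[i.+1]odd_double_half; case: odd; [apply: Po | apply: Pe].
Qed.

(** This is homogeneity: [two_row] has total degree [deg w] in the two variables. *)
Lemma two_rowNN s t w : two_row (- s) (- t) w = (-1) ^+ deg w * two_row s t w.
Proof.
elim/word_hword_ind: w s t => [|n w IHw|n w IHw] s t.
- by rewrite deg1 !two_row1 mul1r.
- rewrite !two_row_even !IHw degM deg_hword exprD.
  have -> : (-1) ^+ n.*2 = 1 :> {poly k} by rewrite -signr_odd odd_double.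
  by rewrite !sqrrN; ring.
rewrite !two_row_odd !IHw degM deg_hword exprD.
have -> : (-1) ^+ n.*2.+1 = -1 :> {poly k} by rewrite -signr_odd /= odd_double.
by rewrite !sqrrN; ring.
Qed.

(** Both parities go into one induction because an odd letter exchanges them. Prefixing a letter
    brings in [two_row s (- t) w], so the hypothesis is also taken at - t, with [two_rowNN]
    normalising the signs. *)
Lemma two_row_symmetry s t w :
  if odd (deg w) then
    s * (two_row s t w + two_row t (- s) w) = t * (two_row t s w + two_row s (- t) w)
  else two_row s t w = two_row t s w.
Proof.
elim/word_hword_ind: w s t => [|n w IHw|n w IHw] s t.
- by rewrite deg1 !two_row1.
- rewrite degM deg_hword oddD odd_double /=.
  have [odd_w|even_w] := boolP (odd (deg w)).
    have := IHw s t; have := IHw s (- t); rewrite odd_w.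
    have -> : two_row (- t) (- s) w = - two_row t s w.
      by rewrite two_rowNN -signr_odd odd_w mulN1r.
    have -> : two_row (- t) s w = - two_row t (- s) w.
      by rewrite -[s in LHS]opprK two_rowNN -signr_odd odd_w mulN1r.
    rewrite !two_row_even !opprK !sqrrN ![hsum _ (t ^+ 2) (s ^+ 2)]hsumC.
    move: (two_row s t w) (two_row t s w) (two_row s (- t) w) (two_row t (- s) w).
    move: (hsum n.+1 _ _) (hsum n _ _) => A B f g h l e1 e2.
    apply/eqP; rewrite -subr_eq0.
    (* The difference of the two sides is A times the hypothesis at (s, t) plus s t B times the
       hypothesis at (s, - t). *)
    have -> : s * (A * f + s * t * B * h + (A * l + t * - s * B * g)) -
        t * (A * g + t * s * B * l + (A * h + s * - t * B * f)) =
        A * (s * (f + l) - t * (g + h)) + s * t * B * (s * (h - g) - - t * (- l + f)).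
      by ring.
    by rewrite e1 e2 !subrr !mulr0 addr0.
  have e1 := IHw s t; have e2 := IHw s (- t); rewrite (negbTE even_w) in e1 e2.
  have e3 : two_row (- t) s w = two_row t (- s) w.
    by rewrite -[s in LHS]opprK two_rowNN -signr_odd (negbTE even_w) mul1r.
  rewrite !two_row_even ![hsum _ (t ^+ 2) (s ^+ 2)]hsumC e1 e2 e3.
  by rewrite [s * t]mulrC.
rewrite degM deg_hword oddD /= odd_double /=.
have [odd_w|even_w] := boolP (odd (deg w)).
  have := IHw s (- t); rewrite odd_w /=.
  have -> : two_row (- t) (- s) w = - two_row t s w.
    by rewrite two_rowNN -signr_odd odd_w mulN1r.
  have -> : two_row (- t) s w = - two_row t (- s) w.
    by rewrite -[s in LHS]opprK two_rowNN -signr_odd odd_w mulN1r.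
  rewrite !two_row_odd !opprK ![hsum _ (t ^+ 2) (s ^+ 2)]hsumC => e.
  congr (_ * _); apply/eqP; rewrite -subr_eq0; apply/eqP.
  move: e => /eqP; rewrite -subr_eq0 => /eqP <-; ring.
have e1 := IHw s t; have e2 := IHw s (- t); rewrite (negbTE even_w) in e1 e2.
have e3 : two_row (- t) s w = two_row t (- s) w.
  by rewrite -[s in LHS]opprK two_rowNN -signr_odd (negbTE even_w) mul1r.
rewrite /= !two_row_odd !opprK !sqrrN ![hsum _ (t ^+ 2) (s ^+ 2)]hsumC e1 e2 e3; ring.
Qed.

End Relations.

(** * Quadratic relations between the generators modulo the radical *)

HB.lock Definition tdeg_part (k : fieldType) (n : nat) (x : freeTens k) : freeTens k :=
  linext (V := freeTens k) (fun q : {fmonom nat} * {fmonom nat} =>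
    (deg q.1 + deg q.2 == n)%:R *: (<< q >> : freeTens k)) x.
Arguments tdeg_part {k} n x.

HB.lock Definition form_hh (k : fieldType) (w : {fmonom nat}) (i j : nat) : k :=
  formf << w >> (hgen k i * hgen k j).

Section StraighteningRelations.
Variable k : fieldType.
Local Notation word := {fmonom nat}.
Local Notation L := {malg k[{fmonom nat}]}.
Local Notation T := (freeTens k).
Implicit Types (x y z : L) (X : T) (s t : {poly k}) (u v w : word) (n i j : nat).

Lemma tdeg_part_is_linear n : linear (@tdeg_part k n).
Proof. by rewrite tdeg_part.unlock; apply: linext_is_linear. Qed.

Lemma tdeg_partU n u v : tdeg_part n (<< (u, v) >> : T) =
  (deg u + deg v == n)%:R *: (<< (u, v) >> : T).
Proof. by rewrite tdeg_part.unlock linext1. Qed.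

Lemma tdeg_partZ n a X : tdeg_part n (a *: X) = a *: tdeg_part n X.
Proof. exact: (linear_funZ a X (tdeg_part_is_linear n)). Qed.

Lemma tdeg_part_sum n m (F : 'I_m -> T) :
  tdeg_part n (\sum_i F i) = \sum_i tdeg_part n (F i).
Proof.
elim/big_rec2: _ => [|i X Y _ <-]; first exact: (linear_fun0 (tdeg_part_is_linear n)).
by have := tdeg_part_is_linear n 1 (F i) Y; rewrite /= !scale1r.
Qed.

Lemma tdeg_part_hM n i j X :
  tdeg_part (i + j + n) (tensf (hgen k i) (hgen k j) * X) =
  tensf (hgen k i) (hgen k j) * tdeg_part n X.
Proof.
move: X; apply: malg_lin_ext.
- apply: (linear_fun_comp (f := @tdeg_part k (i + j + n))); first exact: tdeg_part_is_linear.
  exact: tmul_linearr.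
- apply: (linear_fun_comp (f := fun Y : T => tensf (hgen k i) (hgen k j) * Y)).
    exact: tmul_linearr.
  exact: tdeg_part_is_linear.
move=> [u v]; rewrite tens_hM tdeg_partZ !tdeg_partU !degM !deg_hword.
rewrite [RHS](linear_funZ _ _ (tmul_linearr (tensf (hgen k i) (hgen k j)))).
rewrite [X in _ = _ *: X]tens_hM scalerA mulrC -scalerA.
by have -> : (i + deg u + (j + deg v) == i + j + n)%N = (deg u + deg v == n)%N by lia.
Qed.

Lemma tdeg_part_comultf w : tdeg_part (deg w) (comultf << w >>) = comultf (<< w >> : L).
Proof.
elim/word_ind: w => [|i w IHw].
  by rewrite comultf1 tdeg_partU !deg1 scale1r.
rewrite -malgUM degM -[fmu i]/(hword i.+1) deg_hword -hgenE comultfM comultf_h.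
rewrite /comult_gen mulr_suml tdeg_part_sum; apply: eq_bigr => m _.
have {1}-> : i.+1 = (m + (i.+1 - m))%N by have := ltn_ord m; lia.
by rewrite tdeg_part_hM IHw.
Qed.

(** In terms of cosets: when one subgroup is all of S_n there is a single double coset, and its
    minimal length is 0. *)
Lemma formf_h u i : formf << u >> (hgen k i) = (deg u == i)%:R.
Proof.
rewrite formfUl /deg; elim: (parts u) i => [|p b IHb] i /=.
  by rewrite hgenE mcoeffU -deg_eq0 deg_hword eq_sym.
rewrite perp_h; case: leqP => [le_pi|lt_ip].
  by rewrite IHb; congr (_%:R); apply/eqP/eqP; lia.
rewrite (linear_fun0 (@perps_is_linear k b)) gtn_eqF //.
by rewrite (leq_trans lt_ip) ?leq_addr.
Qed.

Lemma coef_is_linear n : linear (fun p : {poly k} => p`_n : k^o).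
Proof. by move=> a p q; rewrite coefD coefZ. Qed.

(** One variable will be specialised to 1 or -1, so a coefficient fixes only one exponent;
    restricting to total degree [deg w] recovers the other. The factor [c] is the sign left by a
    negative specialisation. *)
Lemma coef_teval (c : k) s t w i j n : (i + j)%N = deg w ->
  (forall u v, (deg u + deg v)%N = deg w ->
    (s ^+ deg v * t ^+ deg u)`_n = c * ((deg u == i) && (deg v == j))%:R) ->
  (two_row s t w)`_n = c * formf << w >> (hgen k i * hgen k j).
Proof.
move=> ij st; rewrite /two_row -pairT_comultf -tdeg_part_comultf.
move: (comultf _); apply: (@malg_lin_ext _ _ k^o).
- apply: (linear_fun_comp (f := fun p : {poly k} => p`_n : k^o)); first exact: coef_is_linear.
  apply: (linear_fun_comp (f := teval s t)); first exact: teval_is_linear.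
  exact: tdeg_part_is_linear.
- apply: (linear_fun_comp (f := fun a : k^o => c * a : k^o)).
    by move=> a x y; rewrite mulrDr; congr (_ + _); exact: mulrCA.
  apply: (linear_fun_comp (f := fun X : T => pairT X (hgen k i) (hgen k j) : k^o)).
    exact: pairT_is_linear.
  exact: tdeg_part_is_linear.
move=> [u v]; rewrite tdeg_partU linearZ /= coefZ tevalU pairTZ pairTU !formf_h.
case: eqP => [/st ->|_]; last by rewrite !mul0r mulr0.
by rewrite mulrCA -natrM mulnb.
Qed.

Lemma formf_hh_neq w i j : (i + j)%N != deg w ->
  formf << w >> (hgen k i * hgen k j) = 0.
Proof. by move=> ne; rewrite !hgenE malgUM formf_neq_deg // degM !deg_hword eq_sym. Qed.

Lemma formfB z x y : formf z (x - y) = formf z x - formf z y.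
Proof. by rewrite !(formfC z) -scaleN1r formfDl formfZl mulN1r. Qed.

Lemma formfDr z x y : formf z (x + y) = formf z x + formf z y.
Proof. by rewrite !(formfC z) formfDl. Qed.

Lemma formfZr z a x : formf z (a *: x) = a * formf z x.
Proof. by rewrite !(formfC z) formfZl. Qed.

Lemma coef_two_row_X1 w j : (j <= deg w)%N ->
  (two_row 'X 1 w)`_j = form_hh k w (deg w - j) j.
Proof.
move=> le_j; rewrite form_hh.unlock -[RHS]mul1r; apply: coef_teval; first by rewrite subnK.
move=> u v uv; rewrite expr1n mulr1 coefXn mul1r eq_sym; congr (_%:R).
by case: eqP => [<-|_]; rewrite ?andbF // andbT -uv addnK eqxx.
Qed.

Lemma coef_two_row_1X w i : (i <= deg w)%N ->
  (two_row 1 'X w)`_i = form_hh k w i (deg w - i).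
Proof.
move=> le_i; rewrite form_hh.unlock -[RHS]mul1r; apply: coef_teval; first by rewrite subnKC.
move=> u v uv; rewrite expr1n mul1r coefXn mul1r eq_sym; congr (_%:R).
by case: eqP => [<-|_] //=; rewrite -uv addKn eqxx.
Qed.

Lemma coef_signM n (p : {poly k}) i : ((-1) ^+ n * p)`_i = (-1) ^+ n * p`_i.
Proof. by rewrite -signr_odd -[in RHS]signr_odd !mulr_sign; case: odd; rewrite ?coefN. Qed.

Lemma coef_NXn n i : ((- 'X) ^+ n : {poly k})`_i = (-1) ^+ i * (n == i)%:R.
Proof.
rewrite (exprNn 'X) coef_signM coefXn eq_sym.
by case: eqP => [->|_]; rewrite ?mulr0.
Qed.

Lemma coef_two_row_1NX w i : (i <= deg w)%N ->
  (two_row 1 (- 'X) w)`_i = (-1) ^+ i * form_hh k w i (deg w - i).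
Proof.
move=> le_i; rewrite form_hh.unlock; apply: coef_teval; first by rewrite subnKC.
move=> u v uv; rewrite expr1n mul1r coef_NXn; congr (_ * _%:R).
by case: eqP => [<-|_] //=; rewrite -uv addKn eqxx.
Qed.

Lemma coef_two_row_XN1 w j : (j <= deg w)%N ->
  (two_row 'X (- 1) w)`_j =
  (-1) ^+ (deg w - j) * form_hh k w (deg w - j) j.
Proof.
move=> le_j; rewrite form_hh.unlock; apply: coef_teval; first by rewrite subnK.
move=> u v uv; rewrite mulrC coef_signM coefXn.
rewrite eq_sym; case: eqP => [<-|_]; rewrite ?andbF ?mulr0 // andbT -uv addnK.
by rewrite eqxx.
Qed.

Lemma form_hh_neq w i j : (i + j)%N != deg w -> form_hh k w i j = 0.
Proof. by move=> ne; rewrite form_hh.unlock formf_hh_neq. Qed.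

Lemma form_hh_even w i j : ~~ odd (i + j) -> form_hh k w i j = form_hh k w j i.
Proof.
move=> even_ij; have [ij|ne] := eqVneq (i + j)%N (deg w); last first.
  by rewrite !form_hh_neq // addnC.
have le_j : (j <= deg w)%N by rewrite -ij leq_addl.
have deg_i : (deg w - j)%N = i by rewrite -ij addnK.
have := two_row_symmetry ('X : {poly k}) 1 w; rewrite -{1}ij (negbTE even_ij) /= => e.
have := congr1 (fun p : {poly k} => p`_j) e.
by rewrite coef_two_row_X1 // coef_two_row_1X // deg_i.
Qed.

Lemma form_hh_odd w i j : ~~ odd (i + j) ->
  form_hh k w i.+1 j + (-1) ^+ j * form_hh k w j i.+1 =
  form_hh k w j.+1 i + (-1) ^+ j * form_hh k w i j.+1.
Proof.
move=> even_ij; have [ij|ne] := eqVneq (i + j).+1 (deg w); last first.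
  by rewrite !form_hh_neq ?mulr0 //; move: ne; apply: contraNN; lia.
have le_j : (j <= deg w)%N by rewrite -ij; lia.
have lt_j : (j < deg w)%N by rewrite -ij; lia.
have deg_i : (deg w - j)%N = i.+1 by lia.
have deg_i' : (deg w - j.+1)%N = i by lia.
have sgn_ij : (-1) ^+ i = (-1) ^+ j :> k.
  by rewrite -signr_odd -[RHS]signr_odd; move: even_ij; rewrite oddD; do 2?case: odd.
have := two_row_symmetry ('X : {poly k}) 1 w; rewrite -{1}ij /= even_ij /= mul1r => e.
have := congr1 (fun p : {poly k} => p`_j.+1) e.
rewrite coefXM coefD coefD /= coef_two_row_X1 // coef_two_row_1NX //.
by rewrite coef_two_row_1X // coef_two_row_XN1 // deg_i deg_i' sgn_ij.
Qed.

Lemma formf_sub_eq0 z a x x' y y' :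
  formf z x + a * formf z x' = formf z y + a * formf z y' ->
  formf z (x + a *: x' - (y + a *: y')) = 0.
Proof.
have D (t t' : L) : formf z (t + a *: t') = formf z t + a * formf z t'.
  by rewrite formfDr; congr (_ + _); exact: formfZr.
move=> e; apply: etrans (formfB _ _ _) _; apply/eqP; rewrite subr_eq0; apply/eqP.
exact: etrans (D x x') (etrans e (esym (D y y'))).
Qed.

Lemma hgen_commute i j : ~~ odd (i + j) ->
  hgen k i * hgen k j - hgen k j * hgen k i \in radical k.
Proof.
move=> /form_hh_even e; apply: radical_words => w.
by have /eqP := e w; rewrite form_hh.unlock -subr_eq0 formfB => /eqP.
Qed.

Lemma hgen_odd_relation i j : ~~ odd (i + j) ->
  hgen k i.+1 * hgen k j + (-1) ^+ j *: (hgen k j * hgen k i.+1) -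
  (hgen k j.+1 * hgen k i + (-1) ^+ j *: (hgen k i * hgen k j.+1)) \in radical k.
Proof.
move=> /form_hh_odd e; apply: radical_words => w.
by apply: formf_sub_eq0; have := e w; rewrite form_hh.unlock.
Qed.

End StraighteningRelations.

(** * Even power sums from Newton's identities *)

Section CourseOfValues.
Variables (A : Type) (a0 : A) (F : nat -> (nat -> A) -> A).

(** A table of the values below [n], so that [bval] and [qval] may refer to all earlier values. *)
Fixpoint course_table n : nat -> A :=
  if n is m.+1 then fun i => if i == m then F m (course_table m) else course_table m i
  else fun=> a0.

Definition course n := course_table n.+1 n.

Lemma courseE : (forall n f g, (forall i, (i < n)%N -> f i = g i) -> F n f = F n g) ->
  forall n, course n = F n course.
Proof.
move=> F_ext n; rewrite /course /= eqxx; apply: F_ext => i.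
elim: n => // n IHn; rewrite ltnS leq_eqVlt => /orP[/eqP ->|lt_in] //=.
by rewrite (ltn_eqF lt_in) IHn.
Qed.

End CourseOfValues.

(* S_p is the adjoint of left multiplication by h_p, H_d the homogeneous
   elements of degree d, and the kernel of pr the radical of the form. *)
Section PowerSums.
Variables (A : pzRingType) (Q : zmodType) (pr : {additive A -> Q}).
Variables (h : nat -> A) (S : nat -> {additive A -> A}) (H : nat -> A -> Prop).
Hypotheses (h0 : h 0 = 1)
  (S_h : forall p n, S p (h n) = if (p <= n)%N then h (n - p) else 0)
  (S0 : forall x, S 0 x = x)
  (SM : forall d p x y, H d x -> S p (x * y) =
    \sum_(r < p.+1) (-1) ^+ ((d + r) * (p - r)) * (S r x * S (p - r) y))
  (H_h : forall n, H n (h n)) (H0 : forall d, H d 0)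
  (HD : forall d x y, H d x -> H d y -> H d (x + y))
  (HN : forall d x, H d x -> H d (- x))
  (HM : forall d e x y, H d x -> H e y -> H (d + e) (x * y))
  (pr_Ml : forall x y, pr x = 0 -> pr (y * x) = 0)
  (pr_Mr : forall x y, pr x = 0 -> pr (x * y) = 0)
  (pr_S0 : forall d x, H d.+1 x -> (forall a, pr (S a.+1 x) = 0) -> pr x = 0).

Lemma signr_double l m n : m = (n + l.*2)%N -> (-1) ^+ m = (-1) ^+ n :> A.
Proof. by move=> ->; rewrite exprD -muln2 mulnC exprM sqrrN !expr1n mulr1. Qed.

Lemma mulr_signCA n (x y : A) : x * ((-1) ^+ n * y) = (-1) ^+ n * (x * y).
Proof. by rewrite !mulrA commr_sign. Qed.

Lemma H_sum n d (F : 'I_n -> A) : (forall i, H d (F i)) -> H d (\sum_i F i).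
Proof. by move=> HF; elim/big_rec: _ => // i x _; apply: HD. Qed.

Lemma H_sign d n x : H d x -> H d ((-1) ^+ n * x).
Proof. by move=> Hx; rewrite -signr_odd mulr_sign; case: odd; [apply: HN|]. Qed.

Lemma H_muln d n x : H d x -> H d (x *+ n).
Proof. by move=> Hx; elim: n => [|n IHn]; rewrite ?mulr0n ?mulrS //; apply: HD. Qed.

(* The odd analogue of the signed elementary functions, fixed by
   sum_i b_i h_(n-i) = 0; bpred n is b_(n-1). *)
Definition bval := course 0 (fun n b =>
  if n is m.+1 then - \sum_(i < n) b i * h (n - i) else 1 : A).

Lemma bval0 : bval 0 = 1.
Proof. by []. Qed.

Lemma bvalS n : bval n.+1 = - \sum_(i < n.+1) bval i * h (n.+1 - i).
Proof.
rewrite [LHS](courseE _ _) // => -[|m] f g fg //; congr (- _).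
by apply: eq_bigr => i _; rewrite fg.
Qed.

Definition bpred n := if n is m.+1 then bval m else 0.

Lemma H_bval n : H n (bval n).
Proof.
elim/ltn_ind: n => -[_|n IHn]; first by rewrite bval0 -h0.
rewrite bvalS; apply/HN/H_sum => i; rewrite -[X in H X](subnKC (ltnW (ltn_ord i))).
exact: HM (IHn _ (ltn_ord i)) (H_h _).
Qed.

(** The counterpart of skewing elementary functions: h_1 lowers e_n to e_(n-1), and h_p with p >= 2
    kills it. *)
Definition S_bval_spec n :=
  S 1%N (bval n) = (-1) ^+ n * bpred n /\ forall a, S a.+2 (bval n) = 0.

Lemma S_bvalM n a y : S_bval_spec n -> S a.+1 (bval n * y) =
  (-1) ^+ (n * a.+1) * (bval n * S a.+1 y) +
  (-1) ^+ (n.+1 * a + n) * (bpred n * S a y).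
Proof.
move=> [S1b S2b]; rewrite (SM _ _ (H_bval n)) big_ord_recl big_ord_recl /= S0 S1b.
rewrite addn0 subn0 big1 => [|i _]; last by rewrite /= S2b mul0r mulr0.
by rewrite addr0 addn1 subSS subn0 -mulrA [in RHS]exprD -mulrA.
Qed.

Lemma S_bval n : S_bval_spec n.
Proof.
elim/ltn_ind: n => -[_|n IHn].
  split=> [|a]; rewrite bval0 -h0 S_h //= mulr0 //.
have S_b a : S a.+1 (bval n.+1) = if a is 0 then (-1) ^+ n.+1 * bval n else 0.
  rewrite bvalS raddfN raddf_sum /=.
  under eq_bigr => i _ do rewrite (S_bvalM _ _ (IHn _ (ltn_ord i))).
  (* The term of index i in the first sum cancels the term of index i + 1 in the second; only the
     last term of the first sum is left, and it vanishes unless a = 0. *)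
  rewrite big_split /= big_ord_recr [X in _ + X]big_ord_recl /= mul0r mulr0 add0r.
  rewrite addrAC -big_split big1 /= ?add0r => [|i _].
    rewrite subSnn S_h; case: a => [|a] /=; last by rewrite mulr0 mulr0 oppr0.
    by rewrite muln1 subnn h0 mulr1 exprS mulN1r mulNr.
  rewrite /bump /= add1n subSS !S_h.
  have le_in := ltnW (ltn_ord i).
  have -> : (a.+1 <= n.+1 - i)%N = (a <= n - i)%N by lia.
  case: leqP => _; last by rewrite !mulr0 addr0.
  have -> : (n.+1 - i - a.+1)%N = (n - i - a)%N by lia.
  rewrite -mulrDl (_ : _ + _ = 0) ?mul0r //.
  have -> : (-1) ^+ (i.+2 * a + i.+1) = (-1) ^+ (i * a.+1).+1 :> A.
    by apply: (@signr_double a); lia.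
  by rewrite exprS mulN1r subrr.
by split=> [|a]; rewrite S_b.
Qed.

(* The signs make S_1 (zsum n) a multiple of zsum (n - 1) that vanishes for odd n,
   so that zsum n is in the radical for odd n, and S_2 (zsum n) = +- zsum (n - 2). *)
Definition zsum n := \sum_(i < n.+1) (-1) ^+ 'C(i.+1, 2) * (bval i * bval (n - i)).

Lemma H_zsum n : H n (zsum n).
Proof.
apply: H_sum => i; apply: H_sign; have le_in : (i <= n)%N by rewrite -ltnS.
rewrite -[X in H X](subnKC le_in).
exact: HM (H_bval _) (H_bval _).
Qed.

Lemma zsum0 : zsum 0 = 1.
Proof. by rewrite /zsum big_ord_recl big_ord0 addr0 !mul1r bval0. Qed.

Lemma zsum1 : zsum 1 = 0.
Proof.
rewrite /zsum !big_ord_recl big_ord0 addr0 /= subn0 subnn !bval0.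
by rewrite /bump /= mul1r mulr1 expr0 mul1r expr1 mulN1r subrr.
Qed.

Lemma S_zsum_term a i j : S a.+1 ((-1) ^+ 'C(i.+1, 2) * (bval i * bval j)) =
  (-1) ^+ 'C(i.+1, 2) * ((-1) ^+ (i * a.+1) * (bval i * S a.+1 (bval j)) +
  (-1) ^+ (i.+1 * a + i) * (bpred i * S a (bval j))).
Proof.
rewrite -(S_bvalM _ _ (S_bval i)) -signr_odd !mulr_sign.
by case: odd; rewrite ?raddfN.
Qed.

Lemma S1_zsum n : S 1%N (zsum n.+1) = zsum n + (-1) ^+ n.+1 * zsum n.
Proof.
rewrite raddf_sum /=; under eq_bigr => i _ do rewrite S_zsum_term mulrDr.
rewrite big_split /= addrC; congr (_ + _).
  (* From i to i + 1 the exponent 'C(i.+1, 2) grows by i + 1, which cancels the Leibniz sign; this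
     is what dictates the binomial exponent. *)
  rewrite big_ord_recl /= mul0r !mulr0 add0r; apply: eq_bigr => i _.
  rewrite /bump /= add1n subSS muln0 add0n S0 mulrA -exprD binS bin1.
  by congr (_ * _); apply: (@signr_double i.+1); lia.
rewrite big_ord_recr /= subnn (S_bval 0).1 !mulr0 addr0 mulr_sumr.
apply: eq_bigr => i _; have le_in : (i <= n)%N by rewrite -ltnS.
rewrite (S_bval _).1 subSn //= mulr_signCA.
rewrite !mulrA -!exprD; congr (_ * _ * _); congr (_ ^+ _).
by have := ltn_ord i; lia.
Qed.

Lemma S2_zsum n : S 2%N (zsum n.+2) = - ((-1) ^+ n * zsum n).
Proof.
have sgn i : (-1) ^+ (i.+1 * 1 + i) = -1 :> A.
  by rewrite -[RHS]expr1; apply: (@signr_double i); lia.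
rewrite raddf_sum /=; under eq_bigr => i _ do
  rewrite S_zsum_term (S_bval _).2 !mulr0 add0r (S_bval _).1 sgn mulN1r mulrN mulr_signCA.
rewrite big_ord_recl /= mul0r !mulr0 oppr0 add0r big_ord_recr /=.
rewrite subnn /= !mulr0 oppr0 addr0 mulr_sumr -sumrN; apply: eq_bigr => i _.
have le_in : (i <= n)%N by rewrite -ltnS.
rewrite /bump /= add1n subSS subSn //=; congr (- _).
rewrite !mulrA -!exprD; congr (_ * _ * _); apply: (@signr_double 1).
by rewrite binS bin1; lia.
Qed.

Lemma S3_zsum a n : S a.+3 (zsum n) = 0.
Proof.
rewrite raddf_sum /= big1 // => i _.
by rewrite S_zsum_term !(S_bval _).2 !mulr0 addr0 mulr0.
Qed.

Lemma pr_zsum_odd n : pr (zsum n.*2.+1) = 0.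
Proof.
elim: n => [|n IHn]; first by rewrite zsum1 raddf0.
apply: (pr_S0 (H_zsum _)) => -[|[|a]].
- rewrite S1_zsum -signr_odd /= odd_double mulN1r subrr; exact: raddf0.
- by rewrite S2_zsum raddfN -signr_odd /= odd_double mulN1r raddfN IHn !oppr0.
by rewrite S3_zsum raddf0.
Qed.

Definition zval n := zsum n.*2.

Lemma pr_S1_zval y n : pr (y * S 1%N (zval n)) = 0.
Proof.
apply: pr_Ml; rewrite /zval; case: n => [|n]; first by rewrite /= zsum0 -h0 S_h raddf0.
by rewrite doubleS S1_zsum raddfD /= pr_Ml pr_zsum_odd ?addr0.
Qed.

(* S_e of z_n modulo the radical. *)
Definition S_zval e n : A :=
  match e, n with
  | 0%N, _ => zval n
  | 2%N, m.+1 => - zval m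
  | _, _ => 0
  end.

Lemma pr_S_zval e n y : pr (y * S e (zval n)) = pr (y * S_zval e n).
Proof.
case: e => [|[|[|e]]] /=; rewrite ?S0 ?pr_S1_zval ?mulr0 ?raddf0 //; last first.
  by rewrite S3_zsum mulr0 raddf0.
case: n => [|n]; first by rewrite /zval zsum0 -h0 S_h mulr0.
by rewrite /zval doubleS S2_zsum -signr_odd odd_double mul1r.
Qed.

Lemma pr_S_zval1 e n : pr (S e (zval n)) = pr (S_zval e n).
Proof. by have := pr_S_zval e n 1; rewrite !mul1r. Qed.

(* Newton's identities, since (-1)^n zval n behaves like an elementary symmetric
   function with S_2 for the skewing by h_1; qval m is the power sum of degree
   2 (m + 1). *)
Definition qval := course 0 (fun m q =>
  - (zval m.+1 *+ m.+1) - \sum_(j < m) q j * zval (m - j) : A).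

Lemma qvalE m : qval m = - (zval m.+1 *+ m.+1) - \sum_(j < m) qval j * zval (m - j).
Proof.
rewrite [LHS](courseE _ _) // => l f g fg; congr (_ - _).
by apply: eq_bigr => i _; rewrite fg.
Qed.

Lemma H_qval m : H m.+1.*2 (qval m).
Proof.
elim/ltn_ind: m => m IHm; rewrite qvalE; apply: HD; first exact/HN/H_muln/H_zsum.
apply/HN/H_sum => j; have -> : m.+1.*2 = (j.+1.*2 + (m - j).*2)%N.
  by have := ltn_ord j; lia.
exact: HM (IHm _ (ltn_ord j)) (H_zsum _).
Qed.

(** If only S_(2m+2) acts on [qval m], the Leibniz rule keeps just the terms r = 0 and r = 2m + 2;
    their signs are trivial because these degrees are even. *)
Lemma pr_qval_zval a m l :
  (forall r, pr (S r.+1 (qval m)) = pr ((r.+1 == m.+1.*2)%:R)) ->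
  pr (S a.+1 (qval m * zval l)) = pr (qval m * S_zval a.+1 l) +
    (if (m.+1.*2 <= a.+1)%N then pr (S_zval (a.+1 - m.+1.*2) l) else 0).
Proof.
move=> S_q; rewrite (SM _ _ (H_qval m)) raddf_sum /= big_ord_recl.
have -> : (-1) ^+ ((m.+1.*2 + (ord0 : 'I_a.+2)) * (a.+1 - (ord0 : 'I_a.+2))) = 1 :> A.
  by rewrite -signr_odd oddM addn0 odd_double.
rewrite mul1r S0 subn0 pr_S_zval; congr (_ + _).
have pr_sign n x : pr x = 0 -> pr ((-1) ^+ n * x) = 0 by exact: pr_Ml.
have term (r : 'I_a.+1) : (r.+1 != m.+1.*2)%N ->
    pr ((-1) ^+ ((m.+1.*2 + lift ord0 r) * (a.+1 - lift ord0 r)) *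
      (S (lift ord0 r) (qval m) * S (a.+1 - lift ord0 r) (zval l))) = 0.
  move=> r_m; apply/pr_sign/pr_Mr; rewrite S_q (negbTE r_m); exact: raddf0.
case: (leqP m.+1.*2 a.+1) => [le_ma|lt_am].
  have lt_m : (m.*2.+1 < a.+1)%N by lia.
  rewrite (bigD1 (Ordinal lt_m)) //= big1 => [|r r_m]; last first.
    by apply: term; apply: contraNneq r_m => e; rewrite -val_eqE /=; lia.
  rewrite addr0; have -> : (bump 0 m.*2.+1) = m.+1.*2 by rewrite /bump add1n doubleS.
  rewrite -signr_odd oddM oddD odd_double /= mul1r.
  have := S_q m.*2.+1; rewrite doubleS eqxx => e.
  have : pr ((S m.*2.+2 (qval m) - 1) * S (a.+1 - m.*2.+2) (zval l)) = 0.
    by apply: pr_Mr; rewrite raddfB e subrr.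
  rewrite mulrBl raddfB => /eqP; rewrite subr_eq0 => /eqP ->.
  by rewrite pr_S_zval mul1r.
by rewrite big1 // => r _; apply: term; have := ltn_ord r; lia.
Qed.

Lemma S_zval_odd e n : S_zval e.*2.+1 n = 0.
Proof. by case: e => // e; rewrite doubleS. Qed.

Lemma S_zval_ge4 e n : S_zval e.+2.*2 n = 0.
Proof. by rewrite doubleS. Qed.

Lemma sum_qval_zval m : \sum_(j < m.+1) qval j * zval (m - j) = - (zval m.+1 *+ m.+1).
Proof.
rewrite big_ord_recr /= subnn {2}/zval zsum0 mulr1 [qval m]qvalE addrC.
by rewrite -addrA addNr addr0.
Qed.

(** Newton's recursion is expanded by [pr_qval_zval]. As [S_zval] can be nonzero only at 0 and 2,
    the cases r + 1 odd, r + 1 = 2 and r + 1 >= 4 behave differently. *)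
Lemma pr_S_qval m r : pr (S r.+1 (qval m)) = pr ((r.+1 == m.+1.*2)%:R).
Proof.
elim/ltn_ind: m r => m IHm r.
have -> : pr (S r.+1 (qval m)) = - (pr (S_zval r.+1 m.+1) *+ m.+1) -
    \sum_(j < m) (pr (qval j * S_zval r.+1 (m - j)) +
      if (j.+1.*2 <= r.+1)%N then pr (S_zval (r.+1 - j.+1.*2) (m - j)) else 0).
  rewrite [in LHS]qvalE (raddfB (S r.+1)) (raddfB pr) (raddfN (S r.+1)) (raddfN pr).
  rewrite (raddfMn (S r.+1)) (raddfMn pr) pr_S_zval1 (raddf_sum (S r.+1)) (raddf_sum pr).
  congr (_ - _); apply: eq_bigr => j _.
  by rewrite pr_qval_zval // => r'; apply: IHm.
have [[e ->]|[e ->]] : (exists e, r.+1 = e.*2.+1) \/ (exists e, r.+1 = e.+1.*2).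
  have e := odd_double_half r; case: (odd r) in e; [right | left]; exists r./2.
    by rewrite doubleS -{1}e.
  by rewrite -{1}e.
- rewrite S_zval_odd raddf0 mul0rn oppr0 sub0r big1 => [|j _].
    by rewrite oppr0 (_ : (_ == _) = false) ?raddf0 //; lia.
  rewrite S_zval_odd mulr0 raddf0 add0r; case: (leqP j.+1.*2 e.*2.+1) => // le_je.
  have -> : (e.*2.+1 - j.+1.*2)%N = (e - j.+1).*2.+1 by lia.
  by rewrite S_zval_odd raddf0.
case: e => [|e].
  rewrite /= raddfN mulNrn opprK.
  have -> : (2 == m.+1.*2)%N = (m == 0%N) by case: m {IHm} => // m; rewrite doubleS.
  case: m {IHm} => [|m].
    by rewrite big_ord0 subr0 mulr1n /zval zsum0.
  rewrite big_split /= [X in _ - (_ + X)]big_ord_recl /= subn0 [X in _ - (_ + (_ + X))]big1.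
    rewrite addr0 raddf0 mulrS.
    (* S_2 lowers every [zval] by one step, so this is the preceding Newton identity. *)
    have -> : \sum_(i < m.+1) pr (qval i * S_zval 2 (m.+1 - i)) = pr (zval m.+1 *+ m.+1).
      have e := congr1 pr (sum_qval_zval m).
      rewrite (raddfN pr) (raddf_sum pr) in e; rewrite -[RHS]opprK -e -sumrN.
      apply: eq_bigr => i _; have le_im : (i <= m)%N by rewrite -ltnS.
      by rewrite subSn //= mulrN raddfN.
    by rewrite raddfMn opprD addrA mulrS -mulrS addrK subrr.
  by [].
rewrite S_zval_ge4 raddf0 mul0rn oppr0 sub0r.
pose z := pr (zval (m - e.+1)).
(* Only j = e + 1, through S_0, and j = e, through S_2, contribute, with opposite signs. They cancel
   except when j = e + 1 falls just outside the range, that is m = e + 1. *)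
have term (j : 'I_m) : pr (qval j * S_zval e.+2.*2 (m - j)) +
    (if (j.+1.*2 <= e.+2.*2)%N then pr (S_zval (e.+2.*2 - j.+1.*2) (m - j)) else 0) =
    (if j == e.+1 :> nat then z else 0) - (if j == e :> nat then z else 0).
  rewrite S_zval_ge4 mulr0 raddf0 add0r leq_double -doubleB subSS.
  rewrite ltnS; case: (ltngtP j e.+1) => [lt_je|lt_ej|->].
  - have -> : (j == e :> nat) = (e.+1 - j == 1)%N by lia.
    have [j_e|ne] := eqVneq (e.+1 - j)%N 1%N.
      have -> : (m - j)%N = (m - e.+1).+1 by have := ltn_ord j; lia.
      by rewrite j_e raddfN sub0r.
    have -> : (e.+1 - j)%N = (e.+1 - j - 2).+2 by lia.
    by rewrite S_zval_ge4 raddf0 subr0.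
  - by rewrite gtn_eqF ?subr0 // (ltn_trans _ lt_ej).
  by rewrite subnn gtn_eqF ?subr0.
rewrite (eq_bigr _ (fun j _ => term j)) big_split /= sumrN.
have sum_if c : \sum_(j < m) (if j == c :> nat then z else 0) = if (c < m)%N then z else 0.
  by rewrite -big_mkcond /= (big_ord1_eq _ (fun=> z)).
rewrite !sum_if.
rewrite opprB [e.+2.*2]doubleS [m.+1.*2]doubleS !eqSS.
have [lt_em|le_me] := ltnP e.+1 m.
  by rewrite (ltnW lt_em) subrr (_ : (_ == _) = false) ?raddf0 //; lia.
have [lt_em|lt_me] := ltnP e m.
  have m_e : m = e.+1 by lia.
  by rewrite /z [in RHS]m_e eqxx m_e subnn /zval zsum0 subr0.
by rewrite subrr (_ : (_ == _) = false) ?raddf0 //; lia.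
Qed.

End PowerSums.

(** * Homogeneous elements, and the power sums inside the free algebra *)

Section PrimitiveDuals.
Variable k : fieldType.
Local Notation word := {fmonom nat}.
Local Notation L := {malg k[{fmonom nat}]}.
Implicit Types (x y z : L) (u v w : word) (d n p : nat).

Lemma homogfU w : homogf (deg w) (<< w >> : L).
Proof. by move=> v /(fsubsetP msuppU_le); rewrite inE => /eqP ->. Qed.

Lemma homogf_h n : homogf n (hgen k n).
Proof. by rewrite hgenE -{1}(deg_hword n); apply: homogfU. Qed.

Lemma homogf0 d : homogf d (0 : L).
Proof. by move=> w; rewrite msupp0 inE. Qed.

Lemma homogfD d x y : homogf d x -> homogf d y -> homogf d (x + y).
Proof.
move=> Hx Hy w /(fsubsetP (msuppD_le _ _)); rewrite in_fsetU.
by case/orP => [/Hx|/Hy].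
Qed.

Lemma homogfN d x : homogf d x -> homogf d (- x).
Proof. by move=> Hx w; rewrite msuppN => /Hx. Qed.

Lemma homogfM d e x y : homogf d x -> homogf e y -> homogf (d + e) (x * y).
Proof. by move=> Hx Hy w /msuppM_le[u [v [/Hx <- /Hy <- ->]]]; rewrite degM. Qed.

Lemma homogf_lin_ext (V : lmodType k) (f g : L -> V) d x :
  linear f -> linear g -> (forall w, deg w = d -> f << w >> = g << w >>) ->
  homogf d x -> f x = g x.
Proof.
move=> lf lg fg Hx; rewrite [x]monalgE.
have : {subset enum_fset (msupp x) <= [pred w | deg w == d]}.
  by move=> w xw; apply/eqP/Hx.
elim: (enum_fset _) => [|w s IHs] s_d; first by rewrite big_nil !linear_fun0.
rewrite big_cons malgZU lf lg IHs => [|v sv]; last by apply: s_d; rewrite inE sv orbT.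
by rewrite fg //; apply/eqP/(s_d w); rewrite inE eqxx.
Qed.

Lemma sgnf_hprod m a : sgnf m (hprod k a) = (-1) ^+ (m * sumn a) *: hprod k a.
Proof. by have [w -> <-] := hprodU k a; rewrite sgnfU. Qed.

(** The skewed element has degree d - r; the exponent uses d + r, of the same parity, to avoid
    truncated subtraction when r > d, where the skewed element is 0. *)
Lemma sgnf_perp m r d x : homogf d x ->
  sgnf m (perp r x) = (-1) ^+ ((d + r) * m) *: perp r x.
Proof.
apply: (@homogf_lin_ext L (fun x => sgnf m (perp r x)) (fun x => _ *: perp r x)).
- exact: linear_fun_comp (sgnf_is_linear m) (perp_is_linear r).
- by move=> a y z; rewrite linearP scalerDr !scalerA [_ * a]mulrC.
move=> w <-; rewrite malgU_hprod perp_hprod linear_sum scaler_sumr /=.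
apply: eq_big_seq => c; rewrite mem_splits => /and3P[/eqP sz le_ca /eqP c_r].
rewrite linearZ /= sgnf_hprod !scalerA; congr (_ *: _); rewrite mulrC; congr (_ * _).
rewrite sumn_seq_sub // c_r -[sumn _]/(deg w).
have le_rd : (r <= deg w)%N.
  by rewrite -c_r (sumn_leq_all2 sz le_ca).
have -> : ((deg w + r) * m = m * (deg w - r) + (r * m).*2)%N by nia.
by rewrite exprD -mul2n (exprM _ 2) sqrrN !expr1n mulr1.
Qed.

Lemma signr_scaleM n x : (-1) ^+ n *: x = (-1) ^+ n * x.
Proof.
rewrite -[in LHS]signr_odd -[in RHS]signr_odd.
by case: odd; rewrite ?expr0 ?expr1 ?scaleN1r ?mulN1r ?scale1r ?mul1r.
Qed.

Lemma perpM_homog d p x y : homogf d x -> perp p (x * y) =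
  \sum_(r < p.+1) (-1) ^+ ((d + r) * (p - r)) * (perp r x * perp (p - r) y).
Proof.
move=> Hx; rewrite perpM; apply: eq_bigr => r _.
by rewrite (sgnf_perp _ _ Hx) signr_scaleM mulrA.
Qed.

Lemma osym_eq0 x : (osym x == 0) = (x \in radical k).
Proof.
rewrite -(linear_fun0 (projmod_is_linear (radical k))) /osym.
by rewrite (projmodP (radical k)) subr0.
Qed.

Lemma osymP x : osym x = 0 <-> x \in radical k.
Proof. by rewrite -osym_eq0; split=> [->|/eqP]. Qed.

(** Positive degree settles the pairing with 1; every other word begins with a generator, which can
    be moved across the form. *)
Lemma radical_of_perps d x : homogf d.+1 x ->
  (forall a, perp a.+1 x \in radical k) -> x \in radical k.
Proof.
move=> Hx Sx; apply: radical_words => w; elim/word_ind: w => [|i w _].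
  rewrite formf1l mcoeff_outdom //; apply/negP => /Hx; rewrite deg1.
  by [].
rewrite -malgUM -[<< fmu i >>]/(hgen k i.+1) formf_hM formfC.
by have /radicalP := Sx i; apply.
Qed.

Lemma perp_power_sum m :
  exists2 q : L, homogf m.+1.*2 q &
    forall r, perp r.+1 q - (r.+1 == m.+1.*2)%:R \in radical k.
Proof.
pose pr : {additive L -> oddSym k} := @projmod _ _ (radical k).
pose S p : {additive L -> L} := perp p.
have rad x : pr x = 0 <-> x \in radical k := osymP x.
exists (qval (hgen k) m) => [|r].
  apply: H_qval; [by []|exact: homogf_h|exact: homogf0|exact: homogfD|exact: homogfN|].
  exact: homogfM.
rewrite -rad raddfB; apply/eqP; rewrite subr_eq0; apply/eqP.
apply: (@pr_S_qval _ _ pr (hgen k) S (@homogf k)) => //.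
- exact: perp_h.
- exact: perp0id.
- exact: perpM_homog.
- exact: homogf_h.
- exact: homogf0.
- exact: homogfD.
- exact: homogfN.
- exact: homogfM.
- by move=> x y /rad x0; apply/rad/radicalM; right.
- by move=> x y /rad x0; apply/rad/radicalM; left.
by move=> d x Hx Sx; apply/rad/(radical_of_perps Hx) => a; apply/rad/Sx.
Qed.

End PrimitiveDuals.

(** * Straightening products of generators *)

Lemma linear_relation (R : comNzRingType) (V : lmodType R) (F : V -> R^o) a b c d e :
  linear F -> F (b + a *: c - (d + a *: e)) = 0 -> F b = F d + a * F e - a * F c.
Proof.
move=> lF; have FD y z : F (y + z) = F y + F z by have := lF 1 y z; rewrite /= !scale1r.
have FZ y : F (a *: y) = a * F y by exact: linear_funZ.
have FN y : F (- y) = - F y by rewrite -scaleN1r linear_funZ // scaleN1r.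
by rewrite FD FN !FD !FZ => /eqP; rewrite subr_eq0 => /eqP <-; rewrite addrK.
Qed.

Lemma linear_eq (R : comNzRingType) (V : lmodType R) (F : V -> R^o) b c :
  linear F -> F (b - c) = 0 -> F b = F c.
Proof.
move=> lF; rewrite -scaleN1r addrC lF scaleN1r addrC => /eqP.
by rewrite subr_eq0 => /eqP.
Qed.

Section Straightening.
Variable k : fieldType.
Local Notation word := {fmonom nat}.
Local Notation L := {malg k[{fmonom nat}]}.
Implicit Types (x y z : L) (u v w : word) (i j n p : nat) (t mu : seq nat).

Lemma formf_mul_linear y x : linear (fun z : L => formf (z * y) x : k^o).
Proof.
apply: (linear_fun_comp (f := fun z : L => formf z x : k^o)) (mul_linearl y).
exact: formf_linearl.
Qed.

Lemma formf_radicalM z y x : z \in radical k -> formf (z * y) x = 0.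
Proof. by move=> z0; have /radicalP -> : z * y \in radical k by apply: radicalM; left. Qed.

Lemma formf_hht_even i j t x : ~~ odd (i + j) ->
  formf (hprod k [:: i, j & t]) x = formf (hprod k [:: j, i & t]) x.
Proof.
have hE a b : hprod k [:: a, b & t] = hgen k a * hgen k b * hprod k t.
  by rewrite !hprod_cons mulrA.
move=> /(hgen_commute k)/(formf_radicalM (hprod k t) x); rewrite (hE i j) (hE j i).
exact: (linear_eq (formf_mul_linear (hprod k t) x)).
Qed.

Lemma formf_hht_odd i j t x : ~~ odd (i + j) ->
  formf (hprod k [:: i.+1, j & t]) x =
  formf (hprod k [:: j.+1, i & t]) x + (-1) ^+ j * formf (hprod k [:: i, j.+1 & t]) x -
  (-1) ^+ j * formf (hprod k [:: j, i.+1 & t]) x.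
Proof.
have hE a b : hprod k [:: a, b & t] = hgen k a * hgen k b * hprod k t.
  by rewrite !hprod_cons mulrA.
move=> /(hgen_odd_relation k)/(formf_radicalM (hprod k t) x).
rewrite (hE i.+1 j) (hE j.+1 i) (hE i j.+1) (hE j i.+1).
exact: (linear_relation (formf_mul_linear (hprod k t) x)).
Qed.

(** Straightening raises the first part to at least j. If i + j is even the two generators commute;
    if it is odd, the quadratic relation yields products starting with h_j or h_(j+1) together with
    h_(i-1) h_(j+1), which the induction on i handles. *)
Lemma formf_hht_eq0 i j t x : (i < j)%N ->
  (forall c s, (j <= c)%N -> (c + sumn s = i + j + sumn t)%N ->
    formf (hprod k (c :: s)) x = 0) ->
  formf (hprod k [:: i, j & t]) x = 0.
Proof.
elim: i j => [|i IHi] j lt_ij D; first by rewrite hprod_cons mul1r D.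
have Dh c d : (j <= c)%N -> (c + d = i.+1 + j)%N ->
    formf (hprod k [:: c, d & t]) x = 0.
  by move=> le_c cd; apply: D => //=; lia.
have [odd_ij|even_ij] := boolP (odd (i.+1 + j)); last first.
  by rewrite formf_hht_even // Dh // addnC.
have even_ij : ~~ odd (i + j) by [].
have D1 : formf (hprod k [:: i, j.+1 & t]) x = 0.
  by apply: IHi => [|c s lt_c cs]; [lia | apply: D; lia].
rewrite (formf_hht_odd _ _ even_ij) D1 (Dh j.+1 i) ?(Dh j i.+1) ?mulr0 ?subr0 ?addr0 //; lia.
Qed.

End Straightening.

(** * Uniqueness of dual elements and the span of the primitives *)

Section PrimitiveSpan.
Variable k : fieldType.
Local Notation word := {fmonom nat}.
Local Notation L := {malg k[{fmonom nat}]}.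
Implicit Types (x y z : L) (u v w : word) (i j n p : nat) (t mu : seq nat).

(* By duality: partitions span modulo the radical iff an element orthogonal to
   all of them is orthogonal to every product of generators. *)
Lemma formf_partitions_eq0 n a x : sumn a = n ->
  (forall mu, is_part mu -> sumn mu = n -> formf (hprod k mu) x = 0) ->
  formf (hprod k a) x = 0.
Proof.
elim/ltn_ind: n a x => n IHn a x a_n part0.
(* Replacing x by its skewing by h_i removes the first part, so the induction on n lets the tail be
   a partition. *)
have hd i t : (0 < i)%N -> (i + sumn t)%N = n ->
    (forall mu, is_part mu -> (i + sumn mu)%N = n -> formf (hprod k (i :: mu)) x = 0) ->
    formf (hprod k (i :: t)) x = 0.
  move=> i_gt0 it_n part_i; rewrite hprod_cons formf_hM.
  apply: (IHn (sumn t)) => // [|mu mu_part mu_t]; first by lia.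
  by rewrite -formf_hM -hprod_cons part_i // mu_t.
(* Here [d] bounds n - i. If the tail starts with some j > i, straightening raises the first part to
   at least j and the bound drops. *)
have part_hd d i t : (n - i < d)%N -> (0 < i)%N -> (i + sumn t)%N = n ->
    formf (hprod k (i :: t)) x = 0.
  elim: d i t => // d IHd i t lt_d i_gt0 it_n; apply: hd it_n _ => // mu mu_part mu_n.
  case: mu mu_part mu_n => [_ i_n|j mu mu_part mu_n].
    by apply: part0; rewrite // /is_part inE eq_sym -lt0n.
  have [le_ji|lt_ij] := leqP j i.
    apply: part0 => //; move: mu_part; rewrite /is_part /= => /andP[-> /=].
    by rewrite !inE /geq /= le_ji !negb_or => /andP[-> ->]; rewrite eq_sym -lt0n i_gt0.
  by apply: formf_hht_eq0 => // c s le_jc cs; apply: IHd; move: mu_n => /=; lia.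
elim: a a_n => [|[|i] a IHa] /= a_n; first by apply: part0.
  by rewrite hprod_cons mul1r IHa.
by apply: (part_hd n.+1); rewrite // ltnS leq_subr.
Qed.

Lemma radical_of_partitions n x : homogf n x ->
  (forall mu, is_part mu -> sumn mu = n -> formf (hprod k mu) x = 0) ->
  x \in radical k.
Proof.
move=> Hx part0; apply: radical_words => w.
have [w_n|ne] := eqVneq (deg w) n.
  by rewrite malgU_hprod (formf_partitions_eq0 w_n).
have : formf << w >> x = 0 :> k^o.
  apply: (homogf_lin_ext (f := formf << w >> : L -> k^o) (g := fun=> 0) _ _ _ Hx).
  - exact: formf_linearr.
  - by move=> a y z; rewrite scaler0 addr0.
  by move=> v v_n; apply: formf_neq_deg; rewrite v_n.
by [].
Qed.

Lemma is_monomial_uniq l (x y : oddSym k) :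
  is_monomial l x -> is_monomial l y -> x = y.
Proof.
move=> [[x' Hx ->] x_l] [[y' Hy ->] y_l].
apply/eqP; rewrite -subr_eq0 -raddfB osym_eq0.
apply: (@radical_of_partitions (sumn l)); first by apply/homogfD/homogfN.
move=> mu mu_part mu_l; rewrite formfB.
rewrite -(form_osym (hprod k mu) x') -(form_osym (hprod k mu) y').
by rewrite x_l // y_l // subrr.
Qed.

Lemma parts_surj mu : 0%N \notin mu -> exists w, parts w = mu.
Proof.
elim: mu => [|[|i] mu IHmu]; [by exists 1%M; rewrite parts1 | by rewrite inE |].
rewrite inE negb_or => /andP[_ /IHmu[w <-]]; exists (fmu i * w)%M.
by rewrite partsM partsU.
Qed.

(** [xget] gives 0 when no element qualifies, so the choice is pinned down by the witness [p]
    together with [is_monomial_uniq]. *)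
Lemma monomial_eq n (p : L) : homogf n p ->
  (forall w, formf << w >> p = (parts w == [:: n])%:R) ->
  m_ k [:: n] = osym p.
Proof.
move=> Hp p_w.
have p_l : is_monomial [:: n] (osym p).
  split=> [|mu mu_part mu_n]; first by rewrite /= addn0; exists p.
  rewrite /h_ form_osym.
  have [|w mu_w] := @parts_surj mu; first by case/andP: mu_part.
  by rewrite -mu_w -malgU_hprod p_w.
by apply: classical_sets.xget_unique => // y y_l; apply: is_monomial_uniq y_l p_l.
Qed.

Lemma parts_nil_eq w : (parts w == [::]) = (w == 1%M).
Proof.
elim/word_ind: w => [|i w _]; first by rewrite parts1 !eqxx.
by rewrite partsM partsU fmM_eq1 fm1_eq1.
Qed.

Lemma formf_radicalr z x y : x - y \in radical k -> formf z x = formf z y.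
Proof.
by move=> /radicalP/(_ z); rewrite formfC formfB => /eqP; rewrite subr_eq0 => /eqP.
Qed.

Lemma even_dual m : exists2 p : L, homogf m.+1.*2 p &
  forall w, formf << w >> p = (parts w == [:: m.+1.*2])%:R.
Proof.
have [q Hq q_perp] := perp_power_sum k m; exists q => // w.
elim/word_ind: w => [|i w _].
  by rewrite formf1l parts1 mcoeff_outdom //; apply/negP => /Hq; rewrite deg1.
rewrite -malgUM -[<< fmu i >>]/(hgen k i.+1) formf_hM (formf_radicalr _ (q_perp i)).
rewrite partsM partsU eqseq_cons parts_nil_eq; case: eqP => _.
  by rewrite formfC formf1_word.
by rewrite formfC formf0l.
Qed.

Lemma one_dual w : formf << w >> (hgen k 1) = (parts w == [:: 1%N])%:R.
Proof.
rewrite formf_h; congr (_%:R); elim/word_ind: w => [|i w _]; first by rewrite deg1 parts1.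
rewrite degM partsM partsU eqseq_cons parts_nil_eq -deg_eq0 -[fmu i]/(hword i.+1).
by rewrite deg_hword; lia.
Qed.

Lemma form_lin (a : k) (x y : oddSym k) z :
  form (a *: x + y) (osym z) = a * form x (osym z) + form y (osym z).
Proof.
rewrite -[x]oliftK -[y]oliftK -[a *: _ + _](projmod_is_linear (radical k)).
by rewrite !form_osym formf_linearl.
Qed.

Lemma primitive_monomial n (p : L) : homogf n p ->
  (forall w, formf << w >> p = (parts w == [:: n])%:R) -> m_ k [:: n] \in primitive k.
Proof.
move=> Hp p_w; rewrite (monomial_eq Hp p_w); apply/primitiveP => w w1.
by rewrite form_osym formfC p_w; case: eqP => // w_n; rewrite w_n in w1.
Qed.

Lemma primitive_span (S : oddSym k -> Prop) : (forall x : oddSym k, S x -> x \in primitive k) ->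
  {subset span_of S <= primitive k}.
Proof.
move=> S_prim x /asboolP[s [s_S ->]]; apply/primitiveP => w w1.
elim: s s_S => [|p s IHs] s_S.
  by rewrite big_nil -(raddf0 (@projmod _ _ (radical k))) form_osym formf0l.
rewrite big_cons form_lin IHs => [|q qs]; last by apply: s_S; rewrite inE qs orbT.
have /S_prim/primitiveP -> // : S p.2 by apply: s_S; rewrite inE eqxx.
by rewrite mulr0 addr0.
Qed.

(** This makes the linear combination in [primitive_in_span] finite. *)
Lemma degree_bound x : exists N, forall n, (N < n)%N -> forall w, deg w = n ->
  formf x << w >> = 0.
Proof.
exists (\max_(w <- enum_fset (msupp x)) deg w) => n lt_n w w_n.
rewrite [x]monalgE formf_suml big_seq big1 // => v xv.
rewrite malgZU formfZl formf_neq_deg ?mulr0 // w_n ltn_eqF //.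
apply: leq_ltn_trans lt_n; elim: (enum_fset _) xv => // u s IHs.
rewrite inE big_cons leq_max => /orP[/eqP ->|/IHs ->]; rewrite ?leqnn ?orbT //.
Qed.

Lemma form_monomial n (p : L) w : homogf n p ->
  (forall u, formf << u >> p = (parts u == [:: n])%:R) ->
  form (m_ k [:: n]) (osym << w >>) = (parts w == [:: n])%:R.
Proof. by move=> Hp p_w; rewrite (monomial_eq Hp p_w) form_osym formfC p_w. Qed.

Lemma form_words_eq0 (x : oddSym k) : (forall w, form x (osym << w >>) = 0) -> x = 0.
Proof.
move=> x0; apply/eqP; rewrite -[x]oliftK osym_eq0; apply: radical_words => w.
by rewrite formfC -(form_osym (olift x)) oliftK x0.
Qed.

(* For odd n >= 3 the relation 2 h_n = h_1 h_(n-1) + h_(n-1) h_1 makes h_n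
   decomposable. *)
Lemma primitive_odd (x : oddSym k) m : (2%:R : k) != 0 -> x \in primitive k ->
  form x (osym << hword m.*2.+3 >>) = 0.
Proof.
move=> k2 /primitiveP x_prim; set n := m.*2.+2.
have formE w : form x (osym << w >>) = formf (olift x) << w >>.
  by rewrite -form_osym oliftK.
(* The odd relation is taken with second index 0, where h_0 = 1 turns both products on its left into
   h_(n+1). *)
have even_n : ~~ odd (n + 0) by rewrite addn0 /= negbK odd_double.
have := hgen_odd_relation k even_n => /radicalP/(_ (olift x)).
rewrite formfC => /(linear_relation (@formf_linearr k (olift x))).
have hh i j : hgen k i * hgen k j = << (hword i * hword j)%M >>.
  by rewrite !hgenE malgUM.
have size_hh i j : size (parts (hword i.+1 * hword j.+1)%M) != 1%N.
  by rewrite partsM !partsU.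
rewrite !hh -!formE (x_prim _ (size_hh 0%N m.*2.+1)) (x_prim _ (size_hh m.*2.+1 0%N)).
rewrite (mulm1 _ : (hword n.+1 * hword 0)%M = _) (mul1m _ : (hword 0 * hword n.+1)%M = _) => e.
have : 2%:R * form x (osym << hword n.+1 >>) = 0.
  by rewrite mulr_natl mulr2n {1}e expr0 !mul1r addr0 sub0r addNr.
by move=> /eqP; rewrite mulf_eq0 (negbTE k2) => /eqP.
Qed.

(** The difference between x and the combination is tested on words: decomposable words vanish by
    primitivity, odd generators of degree at least 3 by [primitive_odd], and the h_2j beyond the
    range by [degree_bound]. *)
Lemma primitive_in_span (x : oddSym k) : (2%:R : k) != 0 -> x \in primitive k ->
  x \in span_of (fun y : oddSym k =>
    y = m_ k [:: 1%N] \/ exists j : nat, (1 <= j)%N /\ y = m_ k [:: (2 * j)%N]).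
Proof.
move=> k2 x_prim; have [N x_N] := degree_bound (olift x).
have formE w : form x (osym << w >>) = formf (olift x) << w >>.
  by rewrite -form_osym oliftK.
pose f n := form x (osym << hword n >>).
(* The coefficients are read off by pairing with h_1 and h_2j; the range j <= N reaches degree 2N,
   past the bound N for x. *)
pose s := (f 1%N, m_ k [:: 1%N]) :: [seq (f (2 * j)%N, m_ k [:: (2 * j)%N]) | j <- iota 1 N].
apply/asboolP; exists s; split=> [p|].
  rewrite inE => /predU1P[->|/mapP[j]]; first by left.
  by rewrite mem_iota => /andP[j_gt0 _] ->; right; exists j.
apply/eqP; rewrite -subr_eq0; apply/eqP/form_words_eq0 => w.
have form_sum (r : seq (k * oddSym k)) z :
    form (\sum_(p <- r) p.1 *: p.2) (osym z) = \sum_(p <- r) p.1 * form p.2 (osym z).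
  elim: r => [|p r IHr].
    by rewrite !big_nil -(raddf0 (@projmod _ _ (radical k))) form_osym formf0l.
  by rewrite !big_cons form_lin IHr.
have form1 := form_monomial w (@homogf_h k 1) one_dual.
have form2 j : (0 < j)%N ->
    form (m_ k [:: (2 * j)%N]) (osym << w >>) = (parts w == [:: (2 * j)%N])%:R.
  case: j => // j _; have [p Hp p_w] := even_dual j.
  by rewrite mul2n; apply: form_monomial Hp p_w.
rewrite -scaleN1r addrC form_lin form_sum big_cons big_map /= form1.
under eq_big_seq => j /[!mem_iota]/andP[j_gt0 _] do rewrite form2 //.
apply/eqP; rewrite mulN1r addrC subr_eq0; apply/eqP.
have [w1|w_n1] := eqVneq (size (parts w)) 1%N; last first.
  have parts_n n : (parts w == [:: n]) = false.
    by apply: contraNF w_n1 => /eqP ->.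
  rewrite ((primitiveP x).1 x_prim) // parts_n mulr0 add0r big1 // => j _.
  by rewrite parts_n mulr0.
have [i w_i] : exists i, w = hword i.+1.
  elim/word_ind: w w1 {form1 form2} => [|i w _]; first by rewrite parts1.
  rewrite partsM partsU /= => -[/size0nil/eqP]; rewrite parts_nil_eq => /eqP ->.
  by exists i; rewrite mulm1.
rewrite {}w_i {w w1 form1 form2}.
have part_i n : (parts (hword i.+1) == [:: n]) = (i.+1 == n).
  by rewrite partsU eqseq_cons andbT.
rewrite part_i; under eq_bigr => j _ do rewrite part_i.
rewrite -[form x _]/(f i.+1).
have [[m i_m]|[m i_m]] : (exists m, i = m.*2) \/ (exists m, i.+1 = m.+1.*2).
  have e := odd_double_half i; case: (odd i) in e; [right | left]; exists i./2.
    by rewrite doubleS -{1}e.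
  by rewrite -{1}e.
  rewrite big1 ?addr0 => [|j _]; last first.
    by rewrite (_ : (_ == _) = false) ?mulr0 //; lia.
  case: m i_m => [->|m ->]; first by rewrite eqxx mulr1.
  rewrite mulr0; exact: primitive_odd.
rewrite i_m (_ : (_ == _) = false) ?mulr0 ?add0r; last by lia.
have [le_mN|lt_Nm] := leqP m.+1 N.
  rewrite (bigD1_seq m.+1) ?iota_uniq ?mem_iota //=.
  rewrite mul2n eqxx mulr1 big1 ?addr0 // => j /eqP j_m.
  by rewrite (_ : (_ == _) = false) ?mulr0 //; lia.
rewrite big_seq big1 => [|j].
  by rewrite /f formE (x_N m.+1.*2) ?deg_hword //; lia.
rewrite mem_iota => /andP[_ lt_j].
by rewrite (_ : (_ == _) = false) ?mulr0 //; lia.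
Qed.

End PrimitiveSpan.

Theorem proposition3p3 (k : fieldType) (hk : [pchar k] =i pred0) :
  primitive k =i
  span_of (fun x : oddSym k =>
    x = m_ k [:: 1%N] \/ exists j : nat, (1 <= j)%N /\ x = m_ k [:: (2 * j)%N]).
Proof.
have k2 : (2%:R : k) != 0 by rewrite (pcharf0P k).1.
move=> x; apply/idP/idP => [/(primitive_in_span k2) //|].
apply: primitive_span => y [->|[[|j] [// _ ->]]].
  exact: primitive_monomial (@homogf_h k 1) (@one_dual k).
have [p Hp p_w] := even_dual k j.
by rewrite mul2n; apply: primitive_monomial Hp p_w.
Qed.
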